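(* Let $X$ be a rational ruled surface and let $L$ be an ample line bundle on $X$. Then for every integer $r \ge L^2+5$, $$\varepsilon(X,L,r) \ge \sqrt{\frac{r+2}{r+3}}\,\sqrt{\frac{L^2}{r}}.$$
   Context: All varieties are over $\mathbb{C}$. A rational ruled surface is a ruled surface over $\mathbb{P}^1$, i.e. $X=\mathbb{P}(\mathcal{O}_{\mathbb{P}^1}\oplus\mathcal{O}_{\mathbb{P}^1}(-e))$ for some integer $e\ge 0$. For a nef line bundle $L$ on $X$ and distinct points $x_1,\ldots,x_r\in X$, the Seshadri constant is $$\varepsilon(X,L,x_1,\ldots,x_r) := \inf_{C} \frac{L\cdot C}{\sum_{i=1}^r \mathrm{mult}_{x_i} C},$$ the infimum being over all curves $C\subset X$ with $C\cap\{x_1,\ldots,x_r\}\neq\emptyset$ (equivalently, irreducible and reduced such curves), and $$\varepsilon(X,L,r) := \max_{x_1,\ldots,x_r\in X} \varepsilon(X,L,x_1,\ldots,x_r),$$ the maximum being over $r$-tuples of distinct points (it is known to be attained at very general points, i.e. for all $(x_1,\ldots,x_r)$ outside some countable union of proper Zariski closed subsets of $X^r$). *)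

(* Defs.v *)
From HB Require Import structures.
From mathcomp Require Import all_boot all_order all_algebra.
From mathcomp Require Import complex.
From mathcomp Require Import mpoly.
From mathcomp Require Import classical_sets reals constructive_ereal ereal.
Set Implicit Arguments.
Unset Strict Implicit.
Unset Printing Implicit Defensive.
Import Order.TTheory GRing.Theory Num.Theory.
Local Open Scope ring_scope.

(* The rational ruled surface X_e = P(O + O(-e)) over P^1 (e >= 0), over
   C = R[i], is presented by its homogeneous (Cox) coordinates s, t, u, v:
     X_e = {(s,t,u,v) | (s,t) <> 0, (u,v) <> 0} / (C^* x C^* ),
     (lambda, mu) . (s,t,u,v) = (lambda s, lambda t, mu lambda^e u, mu v),
   the projection to P^1 being (s : t).
   Pic X_e is Z^2, with basis C0 = {v = 0} (the section with C0^2 = -e) and a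
   fibre f = {s = 0}; the pair (a, b) : int * int stands for O(a C0 + b f). *)

Definition i_s : 'I_4 := @Ordinal 4 0 isT.
Definition i_t : 'I_4 := @Ordinal 4 1 isT.
Definition i_u : 'I_4 := @Ordinal 4 2 isT.
Definition i_v : 'I_4 := @Ordinal 4 3 isT.

Notation line_bundle := (int * int)%type.

(* C0 . C0 = -e, C0 . f = 1, f . f = 0 *)
Definition intersection (e : nat) (D D' : line_bundle) : int :=
  - e%:Z * D.1 * D'.1 + D.1 * D'.2 + D.2 * D'.1.

(* A point of X_e is represented by homogeneous coordinates; two
   representatives define the same point when [same_point] holds. *)
Record point (R : realType) := Point {
  coord :> 'I_4 -> R[i];
  point_base : (coord i_s != 0) || (coord i_t != 0);
  point_fibre : (coord i_u != 0) || (coord i_v != 0) }.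

Definition same_point (R : realType) (e : nat) (p q : point R) : Prop :=
  exists lambda mu : R[i],
    [/\ lambda != 0, mu != 0,
        (q i_s = lambda * p i_s /\ q i_t = lambda * p i_t),
        q i_u = mu * lambda ^+ e * p i_u & q i_v = mu * p i_v].

(* s and t have class f, u has class C0 + e f and v has class C0. *)
Definition monomial_class (e : nat) (m : 'X_{1..4}) : line_bundle :=
  ((m i_u + m i_v)%N%:Z, (m i_s + m i_t + e * m i_u)%N%:Z).

(* F is a global section of the line bundle D. *)
Definition is_section (R : realType) (e : nat) (D : line_bundle)
    (F : {mpoly R[i][4]}) : Prop :=
  forall m : 'X_{1..4}, m \in msupp F -> monomial_class e m = D.

(* The affine chart of X_e centred at p: keep a nonzero coordinate of (s, t)
   and a nonzero coordinate of (u, v), and let the other two vary,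
   with local parameters 'X_0 and 'X_1 respectively. *)
Definition chart (R : realType) (p : point R) : 4.-tuple {mpoly R[i][2]} :=
  let z : {mpoly R[i][2]} := 'X_(@Ordinal 2 0 isT) in
  let w : {mpoly R[i][2]} := 'X_(@Ordinal 2 1 isT) in
  [tuple (p i_s)%:MP + (if p i_s == 0 then z else 0);
         (p i_t)%:MP + (if p i_s == 0 then 0 else z);
         (p i_u)%:MP + (if p i_u == 0 then w else 0);
         (p i_v)%:MP + (if p i_u == 0 then 0 else w)].

Definition local_eq (R : realType) (p : point R) (F : {mpoly R[i][4]}) :
    {mpoly R[i][2]} := F \mPo chart p.

(* Multiplicity at p of the curve F = 0: the order of vanishing at the origin
   of a local equation (the default value [msize] is never the minimum when
   the local equation is nonzero). *)
Definition mult (R : realType) (p : point R) (F : {mpoly R[i][4]}) : nat :=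
  \big[minn/msize (local_eq p F)]_(m <- msupp (local_eq p F)) mdeg m.

Definition irreducible_mpoly (R : realType) (F : {mpoly R[i][4]}) : Prop :=
  [/\ F != 0, F \isn't a GRing.unit &
      forall G H : {mpoly R[i][4]}, F = G * H ->
        G \is a GRing.unit \/ H \is a GRing.unit].

(* Irreducible reduced curves of class D on X_e, given by their equation
   (unique up to a nonzero scalar). *)
Definition is_curve (R : realType) (e : nat) (D : line_bundle)
    (F : {mpoly R[i][4]}) : Prop :=
  is_section e D F /\ irreducible_mpoly F.

(* The complete linear system |D| defines a closed embedding in a projective
   space: global sections separate points and tangent vectors, the latter
   meaning that the sections vanishing at p span m_p / m_p^2. *)
Definition very_ample (R : realType) (e : nat) (D : line_bundle) : Prop :=
  (forall p q : point R, ~ same_point e p q ->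
     exists F : {mpoly R[i][4]},
       [/\ is_section e D F, F.@[p] = 0 & F.@[q] != 0]) /\
  (forall (p : point R) (c0 c1 : R[i]),
     exists F : {mpoly R[i][4]},
       [/\ is_section e D F,
           (local_eq p F)@_0%MM = 0,
           (local_eq p F)@_(U_(@Ordinal 2 0 isT))%MM = c0 &
           (local_eq p F)@_(U_(@Ordinal 2 1 isT))%MM = c1]).

Definition ample (R : realType) (e : nat) (L : line_bundle) : Prop :=
  exists2 n : nat, (0 < n)%N & very_ample R e (L *+ n).

Definition distinct_points (R : realType) (e r : nat)
    (x : 'I_r -> point R) : Prop :=
  forall i j : 'I_r, i != j -> ~ same_point e (x i) (x j).

(* Infima and suprema are taken in the extended reals, so that no convention
   for empty or unbounded sets is involved. *)
Definition seshadri_at (R : realType) (e : nat) (L : line_bundle) (r : nat)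
    (x : 'I_r -> point R) : \bar R :=
  ereal_inf [set q : \bar R |
    exists (D : line_bundle) (F : {mpoly R[i][4]}),
      [/\ is_curve e D F,
          (exists i : 'I_r, F.@[x i] = 0) &
          q = ((intersection e L D)%:~R
                 / (\sum_(i < r) mult (x i) F)%N%:R)%:E]]%classic.

(* The supremum below is attained, at very general points. *)
Definition seshadri (R : realType) (e : nat) (L : line_bundle) (r : nat) :
    \bar R :=
  ereal_sup [set q : \bar R | exists2 x : 'I_r -> point R,
    distinct_points e x & q = seshadri_at e L x]%classic.

(* Main.v *)
Require Import Defs.
From mathcomp Require Import all_boot all_order all_algebra.
From mathcomp Require Import complex mpoly.
From mathcomp Require Import classical_sets reals constructive_ereal ereal.
From HB Require Import structures.
From mathcomp Require Import perm generic_quotient zify lra.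
From mathcomp Require boolp.

(** Write L = a C0 + (e a + c) f. Ampleness means a, c > 0 ([ample_bounds]), so
    L^2 = a (e a + 2 c) > 0. It is enough to find one configuration x_1, ..., x_r
    for which every irreducible curve D through some x_i, of multiplicities m_i
    and with M = sum m_i, satisfies (r + 2) L^2 M^2 <= r (r + 3) (L . D)^2. The
    points are taken very general, with coordinates (1, z_i, 1, w_i).

    In the chart s = u = 1 a curve of class al C0 + (e al + d) f becomes a
    polynomial f in C[Z][W] whose Newton polygon lies in a trapezoid, and
    D^2 = al (2 d + e al). The geometric input is the inequality of Ein,
    Lazarsfeld and Xu,
      D^2 >= sum_i m_i^2 - m_j   whenever m_j > 0   ([self_intersection_bound]).
    The conditions of vanishing to order m_i at the points are linear in the
    coefficients, with entries polynomial in the coordinates Y of the points.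
    For very general points a solution f is accompanied by a solution v with
    entries polynomial in Y ([generic_section]). If v, evaluated at the points,
    is not proportional to f, then Bezout gives D^2 >= sum m_i^2. Otherwise
    differentiate v along one of the two coordinates of x_j: this gives a second
    section g with at least the same multiplicities at the other points and with
    multiplicity exactly m_j - 1 at x_j, hence not a multiple of f, and Bezout
    for f and g gives the inequality. Bezout itself ([bezout]) is read off the
    resultant in W: its degree in Z is bounded by D^2 through the shape of the
    trapezoid, and it vanishes to order at least m_i k_i at z_i; it is nonzero
    since f is irreducible and does not divide g, by Gauss's lemma.

    The rest is arithmetic. By the Hodge index inequality L^2 D^2 <= (L . D)^2 it
    is enough that (r + 2) M^2 <= r (r + 3) D^2, and this follows from the
    inequality above with m_j the least positive multiplicity, except when M = 1,
    where L . D >= 1 suffices, and when all m_i = 1 and D^2 = r - 1. In the latter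
    case f and the sections g_j, one for each point, are independent
    ([independent_sections]), so that D has at least r + 1 = D^2 + 2 sections.
    This forces D to be rational: al = 1, or e = 0 and d = 1. For such classes
    the bound is checked directly, and r >= L^2 + 5 is what makes it true
    ([exceptional_class]). *)

Set Implicit Arguments.
Unset Strict Implicit.
Unset Printing Implicit Defensive.
Import Order.TTheory GRing.Theory Num.Theory.
Local Open Scope ring_scope.

(** * Arithmetic of multiplicities and classes *)

Section Arithmetic.
Local Open Scope nat_scope.

Lemma sum_ord_gauss n : (2 * \sum_(l < n.+1) l = n * n.+1)%N.
Proof. by elim: n => [|n IHn]; rewrite ?big_ord1 // big_ord_recr /= mulnDr IHn; lia. Qed.

(** Here n is the number of points on the curve, M and Q the sums of the m_i and of
    the m_i^2, mu the least positive m_i. Cauchy's inequality Q >= M^2 / n and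
    mu <= M / n give Q - mu >= M (M - 1) / n, which is enough when n < r and M >= 2. *)
Lemma few_points_bound r n M mu Q : 6 <= r -> 2 <= M -> 0 < n -> n < r -> n <= M ->
    n * mu <= M -> M * M <= n * Q ->
  (r + 2) * (M * M) + r * (r + 3) * mu <= r * (r + 3) * Q.
Proof.
move=> r6 M2 n0 ltnr lenM lemu leQ.
have key : n * (r + 2) * M + r * (r + 3) <= r * (r + 3) * M.
  have [leMr|ltrM] := leqP M r.-1.
    have h : M * M + 2 * r <= (r + 1) * M + 2 by nia.
    have h1 : n * (r + 2) * M <= (r + 2) * (M * M) by nia.
    have h2 : (r + 2) * (M * M) + 2 * r * (r + 2) <= (r + 2) * ((r + 1) * M) + 2 * (r + 2) by nia.
    nia.
  have h1 : n * (r + 2) * M + (r + 2) * M <= r * (r + 2) * M by nia.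
  nia.
rewrite -(leq_pmul2l n0).
have h1 : r * (r + 3) * (n * mu) <= r * (r + 3) * M by rewrite leq_mul2l lemu orbT.
have h2 : r * (r + 3) * (M * M) <= r * (r + 3) * (n * Q) by rewrite leq_mul2l leQ orbT.
have h3 : (n * (r + 2) * M + r * (r + 3)) * M <= (r * (r + 3) * M) * M by rewrite leq_mul2r key orbT.
lia.
Qed.

(** When the curve meets all the points, Cauchy's inequality is enough for
    M >= r + 3. For M = r + 1 and M = r + 2 the least multiplicity is 1, and
    integrality, in the form sum (m_i - 1)(m_i - 2) >= 0, replaces it. *)
Lemma all_points_bound r M mu Q : 6 <= r -> r < M -> r * mu <= M -> M * M <= r * Q ->
    3 * M <= Q + 2 * r ->
  (r + 2) * (M * M) + r * (r + 3) * mu <= r * (r + 3) * Q.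
Proof.
move=> r6 ltrM lemu leQ leQ3.
have [le3|lt3] := leqP (r + 3) M.
  have r0 : 0 < r by lia.
  rewrite -(leq_pmul2l r0).
  have h1 : r * (r + 3) * (r * mu) <= r * (r + 3) * M by rewrite leq_mul2l lemu orbT.
  have h2 : r * (r + 3) * (M * M) <= r * (r + 3) * (r * Q) by rewrite leq_mul2l leQ orbT.
  have h3 : (r + 3) * M <= M * M by rewrite leq_mul2r le3 orbT.
  nia.
have mu1 : mu <= 1 by nia.
have [E|E] : M = r + 1 \/ M = r + 2 by lia.
  have Q3 : r + 3 <= Q by lia.
  subst M; nia.
have Q6 : r + 6 <= Q by lia.
subst M; nia.
Qed.

Section Multiplicities.
Variables (r : nat) (m : 'I_r -> nat).
Let M := \sum_i m i.
Let Q := \sum_i m i * m i.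
Let n := \sum_i (0 < m i).

(** Cauchy's inequality, summed from 2 m_i m_j <= m_i^2 + m_j^2 over the pairs of
    indices with m_i, m_j > 0: only the n indices in the support count. *)
Lemma sum_sqr_le : M * M <= n * Q.
Proof.
have E : 2 * (M * M) <= \sum_i \sum_j ((0 < m j) * (m i * m i) + (0 < m i) * (m j * m j)).
  rewrite big_distrl big_distrr /=; apply: leq_sum => i _.
  rewrite !big_distrr /=; apply: leq_sum => j _.
  have [+ _] := nat_Cauchy (m i) (m j); rewrite -!mulnn.
  by case: (m i) (m j) => [|a] [|b] //=; lia.
rewrite -(leq_pmul2l (m := 2)) //; apply: leq_trans E _.
under eq_bigr do rewrite big_split /= -big_distrl -big_distrr /=.
rewrite big_split /= -big_distrr -big_distrl /=.
by rewrite -/n -/Q mul2n -addnn.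
Qed.

(** The point j is one of least positive multiplicity. A curve of multiplicity 1
    at every point really escapes the bound, since then the sum is r - 1. *)
Lemma multiplicity_bound : 6 <= r -> 2 <= M ->
  (forall i, m i = 1) \/
  exists2 j, 0 < m j &
    (r + 2) * (M * M) <= r * (r + 3) * \sum_i m i * (m i - (i == j)).
Proof.
move=> r6 M2.
have [j0 mj0] : exists j, 0 < m j.
  apply/existsP; apply: contraTT M2 => /existsPn m0; rewrite -ltnNge /M big1 // => i _.
  by have := m0 i; rewrite -eqn0Ngt => /eqP.
have [j mj jmin] := @arg_minnP _ j0 (fun i => 0 < m i) m mj0.
have QE : \sum_i m i * (m i - (i == j)) + m j = Q.
  rewrite /Q (bigD1 j) //= [RHS](bigD1 j) //= eqxx addnAC; congr (_ + _); first by nia.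
  by apply: eq_bigr => i /negPf->; rewrite subn0.
have le_n : n <= M by apply: leq_sum => i _; case: (m i).
have n0 : 0 < n by rewrite /n (bigD1 j) //= mj.
have nr : n <= r by rewrite -[r in _ <= r]card_ord -sum1_card; apply: leq_sum => i _; case: (m i).
have le_mu : n * m j <= M.
  rewrite /n big_distrl /=; apply: leq_sum => i _.
  by case: posnP => [->//|mi]; rewrite mul1n jmin.
have le_Q : 3 * M <= Q + 2 * n.
  rewrite /M /Q /n !big_distrr -big_split /=; apply: leq_sum => i _.
  by case: (m i) => [|[|a]] //=; nia.
have cauchy := sum_sqr_le.
suff H : (forall i, m i = 1) \/ (r + 2) * (M * M) + r * (r + 3) * m j <= r * (r + 3) * Q.
  case: H => [|H]; [by left | right; exists j => //].
  by move: H; rewrite -QE (mulnDr (r * (r + 3))) leq_add2r.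
move: nr; rewrite leq_eqVlt => /predU1P[nr|nr]; last by right; apply: (few_points_bound (n := n)).
rewrite nr in le_mu le_Q cauchy le_n.
have [leM|ltM] := leqP M r; last by right; apply: all_points_bound.
left => i.
have pos k : 0 < m k.
  rewrite lt0n; apply/negP => /eqP mk; suff : n < r by rewrite nr ltnn.
  rewrite /n (bigD1 k) //= mk add0n -[r in _ < r]card_ord -sum1_card [X in _ < X](bigD1 k) //= add1n ltnS.
  by apply: leq_sum => h _; case: (m h).
apply/eqP; rewrite eqn_leq pos andbT leqNgt; apply/negP => mi.
suff : r < M by rewrite ltnNge leM.
rewrite -[r in r < _]card_ord -sum1_card /M (bigD1 i) //= [X in _ < X](bigD1 i) //=.
by rewrite -addSn; apply: leq_add => //; apply: leq_sum => h _; apply: pos.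
Qed.

End Multiplicities.

Section Surface.
Variables (e a c al d : nat).

(* With L = a C0 + (e a + c) f and D = al C0 + (e al + d) f, these are L . L,
   L . D and D . D. *)
Let LL := a * (e * a + 2 * c).
Let LD := a * d + (e * a + c) * al.
Let DD := al * (d + d + e * al).

(** The defect (L . D)^2 - L^2 D^2 is the square (a d - c al)^2. *)
Lemma hodge_index : LL * DD <= LD * LD.
Proof.
have [+ _] := nat_Cauchy (a * d) (c * al); rewrite -!mulnn /LL /LD /DD.
lia.
Qed.

(** The two hypotheses on D say that it has at least D^2 + 2 sections, which is
    Riemann-Roch for a curve of genus at most 0. Together with D^2 >= 5 this
    leaves only the sections of the ruling and, for e = 0, those of the other
    ruling. The two cases are exchanged by swapping the roles of a and c, and are
    proved together with x = a or x = c. *)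
Lemma exceptional_class r : 0 < a -> 0 < c -> LL + 5 <= r -> DD = r.-1 ->
    r < al.+1 * d.+1 + e * \sum_(l < al.+1) l ->
  (r + 2) * LL * (r * r) <= r * (r + 3) * (LD * LD).
Proof.
move=> a0 c0 LLr DDr; have := sum_ord_gauss al; move: (\sum_(l < _) l) => S S2 ltr.
have LL0 : 0 < LL by rewrite /LL !(muln_gt0, addn_gt0) a0 c0 orbT.
have r5 : 5 < r by apply: leq_trans LLr; rewrite -addn1 addnC leq_add2r.
have al0 : 0 < al.
  by rewrite lt0n; apply/eqP => al0; move: DDr; rewrite /DD al0 mul0n => E; lia.
have key : al = 1 \/ e = 0 /\ d = 1.
  have [al1|al2] : al = 1 \/ 2 <= al by lia.
    by left.
  right; have E : al * (2 * d + e * al) + 1 = r by rewrite -[RHS]prednK -?DDr /DD; lia.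
  (* T = 2 d + e al satisfies (al - 1) T <= 2 (al - 1). *)
  have T2 : 2 * d + e * al <= 2.
    have h : 2 * (al * (2 * d + e * al)) + 4 <= al.+1 * (2 * d + e * al + 2).
      have : 2 * (e * S) = e * (al * al.+1) by rewrite -S2 mulnCA.
      lia.
    by move: h al2; move: (2 * d + e * al) => T; nia.
  have [e0|e1] := posnP e.
    by split=> //; move: E T2; rewrite e0 mul0n addn0 => E T2; nia.
  have d0 : d = 0 by nia.
  by exfalso; move: E T2; rewrite d0 muln0 add0n => E T2; nia.
have main x s : 0 < x -> x * s + 5 <= r -> LL = x * s -> 2 * LD = s + x * r.-1 ->
    (r + 2) * LL * (r * r) <= r * (r + 3) * (LD * LD).
  move=> x0 xs LLE LDE.
  (* (s + x (r - 1))^2 = (x (r - 1) - s)^2 + 4 s x (r - 1), and the first square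
     is at least 16 because s <= r - 5. *)
  have le_s : s + 4 <= x * r.-1 by nia.
  have r0 : 0 < r by lia.
  have E : 4 * (LD * LD) = (s + x * r.-1) * (s + x * r.-1) by rewrite -LDE; lia.
  suff H : 4 * ((r + 2) * (x * s) * r) <= (r + 3) * (4 * (LD * LD)).
    rewrite LLE; move: (LD * LD) H => U H.
    have {}H : (r + 2) * (x * s) * r <= (r + 3) * U by lia.
    by have := leq_mul (leqnn r) H; lia.
  rewrite E -(subnKC le_s); move: (x * r.-1 - (s + 4)) (subnKC le_s) => t xE.
  have h1 : (s + (s + 4 + t)) * (s + (s + 4 + t)) =
     (4 + t) * (4 + t) + 4 * (s * (x * r.-1)) by rewrite -xE; lia.
  rewrite h1; have h2 : (r + 3) * (s * (x * r.-1)) + 3 * (x * s) = (r + 2) * (x * s) * r.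
    by rewrite -[r in LHS]prednK // -[r in RHS]prednK //=; lia.
  have h3 : 16 <= (4 + t) * (4 + t) by lia.
  have h4 : (r + 3) * 16 <= (r + 3) * ((4 + t) * (4 + t)) by rewrite leq_mul2l h3 orbT.
  lia.
case: key => [al1|[e0 d1]].
  apply: (main a (e * a + 2 * c)) => //; rewrite -DDr /LD /DD al1; lia.
apply: (main c (2 * a)) => //; rewrite -?DDr; move: LLr; rewrite /LL /LD /DD e0 ?d1; lia.
Qed.

End Surface.

End Arithmetic.

(** * Points avoiding countably many hypersurfaces *)

(** Nested intervals: the n-th step keeps an outer third of the current interval,
    on the side of the middle where x n is not. *)
Lemma real_avoid_seq (R : realType) (x : nat -> R) : exists c, forall n, c != x n.
Proof.
pose step n (ab : R * R) :=
  if x n < (ab.1 + ab.2) / 2 then ((ab.1 + 2 * ab.2) / 3, ab.2)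
  else (ab.1, (2 * ab.1 + ab.2) / 3).
pose I := fix I n := if n is n'.+1 then step n' (I n') else (0, 1).
have ltI n : (I n).1 < (I n).2.
  elim: n => [|n IHn] //=; rewrite /step; case: ifP => _ /=; lra.
have monoI n k : (I n).1 <= (I (n + k)%N).1 /\ (I (n + k)%N).2 <= (I n).2.
  elim: k => [|k [IH1 IH2]]; rewrite ?addn0 // addnS /= /step.
  have := ltI (n + k)%N; case: ifP => _ /=; lra.
have leI n k : (I n).1 <= (I k).2.
  have [le_nk|/ltnW le_kn] := leqP n k.
    by have [+ _] := monoI n (k - n)%N; rewrite subnKC //; have := ltI k; lra.
  by have [_ +] := monoI k (n - k)%N; rewrite subnKC //; have := ltI n; lra.
pose E := [set y | exists n, y = (I n).1]%classic.
have E0 : (E !=set0)%classic by exists 0; exists 0%N.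
have ubE k : ubound E (I k).2 by move=> _ [n ->].
exists (sup E) => n; have h1 : sup E <= (I n.+1).2 by apply: ge_sup.
have h2 : (I n.+1).1 <= sup E.
  apply: ub_le_sup; last by exists n.+1.
  by exists (I 0%N).2; apply: ubE.
move: (ltI n) h1 h2; rewrite /= /step.
by case: (ltP (x n)) => /= xn h1 h2 h3; apply/eqP => supE; lra.
Qed.

Lemma poly_avoid (R : realType) (p : nat -> {poly R[i]}) :
  (forall n, p n != 0) -> exists c : R[i], forall n, (p n).[c] != 0.
Proof.
move=> p0; pose rt n := sval (closed_field_poly_normal (p n)).
pose x k := complex.Re (nth 0 (rt (odflt (0, 0) (unpickle k)).1%N) (odflt (0, 0) (unpickle k)).2%N).
have [c cx] := real_avoid_seq x; exists c%:C%C => n.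
have pE := svalP (closed_field_poly_normal (p n)); rewrite -/(rt n) in pE.
apply/negP => /eqP pc0; have /(nthP 0)[j _ jE] : c%:C%C \in rt n.
  by move/eqP: pc0; rewrite -rootE pE rootZ ?lead_coef_eq0 ?p0 // root_prod_XsubC.
by case/eqP: (cx (pickle (n, j))); rewrite /x pickleK /= jE.
Qed.

Lemma muni_eq0 (R : idomainType) n (p : {mpoly R[n.+1]}) : muni p = 0 -> p = 0.
Proof.
move=> p0; apply/mpolyP => m; rewrite mcoeff0.
pose m' := [multinom m (widen_ord (leqnSn n) i) | i < n].
have := congr1 (fun q : {poly {mpoly R[n]}} => q`_(m ord_max)@_m') p0.
rewrite coef0 mcoeff0 muniE coef_sum raddf_sum /= => E.
have [mp|mp] := boolP (m \in msupp p); last by apply: memN_msupp_eq0.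
rewrite -E (bigD1_seq m) ?msupp_uniq //= !coefZ coefXn eqxx mulr1 mcoeffZ mcoeffX eqxx mulr1.
rewrite big1 ?addr0 // => m1 nm; rewrite !coefZ coefXn; case: eqP => [mm|_]; last by rewrite mulr0 mcoeff0.
rewrite mulr1 mcoeffZ mcoeffX; case: eqP => [mm'|_]; last by rewrite mulr0.
case/eqP: nm; apply/mnmP => i; have [j ->|->] := unliftP ord_max i; last by [].
have := congr1 (fun m : 'X_{1..n} => m j) mm'; rewrite !mnmE.
by rewrite (_ : widen_ord _ _ = lift ord_max j) //; apply: val_inj; rewrite /= /bump leqNgt ltn_ord.
Qed.

Lemma meval_muni (R : idomainType) n (p : {mpoly R[n.+1]}) (y : 'I_n.+1 -> R) :
  p.@[y] = (map_poly (meval (fun i => y (lift ord_max i))) (muni p)).[y ord_max].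
Proof.
rewrite mevalE muniE rmorph_sum horner_sum; apply: eq_bigr => m _ /=.
rewrite !map_polyZ hornerZ map_polyXn hornerXn big_ord_recr /= mulrA; congr (_ * _).
rewrite mevalZ mevalX; congr (_ * _); apply: eq_bigr => i _; rewrite mnmE.
by rewrite (_ : widen_ord _ _ = lift ord_max i) //; apply: val_inj; rewrite /= /bump leqNgt ltn_ord.
Qed.

(** Induction on the number of variables: avoid first the zeros of the leading
    coefficients in the last variable, then the roots of the resulting countably
    many nonzero polynomials in that variable. *)
Lemma mpoly_avoid (R : realType) n (g : nat -> {mpoly R[i][n]}) :
  (forall k, g k != 0) -> exists y : 'I_n -> R[i], forall k, (g k).@[y] != 0.
Proof.
elim: n g => [|n IHn] g g0.
  exists (fun=> 0) => k; move: (g0 k).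
  by rewrite [g k]nvar0_mpolyC_eq // mpolyC_eq0 mevalC.
have u0 k : muni (g k) != 0 by apply: contraNneq (g0 k) => /muni_eq0->.
have [|y' y'P] := IHn (fun k => lead_coef (muni (g k))).
  by move=> k; rewrite lead_coef_eq0.
have [|c cP] := @poly_avoid R (fun k => map_poly (meval y') (muni (g k))).
  by move=> k; rewrite -lead_coef_eq0 lead_coef_map_eq y'P.
exists (fun i => oapp y' c (unlift ord_max i)) => k.
rewrite meval_muni unlift_none /=; apply: contraNN (cP k) => /eqP <-; apply/eqP.
by congr (_.[_]); apply: eq_map_poly => q; apply: meval_eq => i; rewrite liftK.
Qed.

(** * Kernels of matrices depending on parameters *)

Section GenericKernel.
Variable D : idomainType.
Local Notation F := {fraction D}.
Local Notation "x %:F" := (@tofrac D x).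

Lemma fraction_clear1 (x : F) : exists2 d : D, d != 0 & exists n : D, d%:F * x = n%:F.
Proof.
elim/quotW: x => x; exists (\d_x); first exact: denom_ratioP.
exists (\n_x); apply/eqP; rewrite -[_ * _]/(FracField.mul _ _) !piE /= FracField.equivfE /=.
by rewrite /FracField.mulf !numden_Ratio ?oner_eq0 ?mulf_neq0 ?denom_ratioP ?oner_eq0 // mul1r mulr1.
Qed.

Lemma fraction_clear (T : finType) (x : T -> F) :
  exists2 d : D, d != 0 & exists n : T -> D, forall t, d%:F * x t = (n t)%:F.
Proof.
have [d d0 /(_ _ _)] : exists2 d : D, d != 0 &
    forall t, t \in enum T -> exists n : D, d%:F * x t = n%:F.
  elim: (enum T) => [|t s [d d0 ds]]; first by exists 1; rewrite ?oner_neq0.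
  have [d1 d10 [n1 E1]] := fraction_clear1 (x t).
  exists (d * d1) => [|t']; first by rewrite mulf_neq0.
  rewrite inE => /predU1P[->|/ds[n E]].
    by exists (d * n1); rewrite !tofracM -mulrA E1.
  by exists (n * d1); rewrite !tofracM mulrAC E.
move=> H; exists d => //.
have {}H t : exists n : D, d%:F * x t == n%:F.
  by have [n /eqP] := H t (mem_enum T t); exists n.
by exists (fun t => xchoose (H t)) => t; apply/eqP/(xchooseP (H t)).
Qed.

(** A system of linear equations with parameters: outside the hypersurface g = 0,
    a nontrivial solution of the specialized system exists only if there is a
    solution with parameters, and the latter may be chosen nonzero after
    specialization. Over the fraction field the rows of M are either free, and
    then a right inverse multiplied by a common denominator g shows that M keeps
    a trivial kernel wherever g is nonzero, or dependent, and then g is a nonzero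
    coordinate of a relation with denominators cleared. *)
Lemma generic_kernel (I P : finType) (M : I -> P -> D) :
  exists2 g : D, g != 0 & forall (C : fieldType) (ev : {rmorphism D -> C}),
    ev g != 0 -> forall c : I -> C,
    (forall p, \sum_i c i * ev (M i p) = 0) -> (exists i, c i != 0) ->
  exists2 v : I -> D, forall p, \sum_i v i * M i p = 0 & exists i, ev (v i) != 0.
Proof.
pose A : 'M[F]_(#|I|, #|P|) := \matrix_(i, j) (M (enum_val i) (enum_val j))%:F.
have sumI (R : nzSemiRingType) (f : I -> R) : \sum_(i < #|I|) f (enum_val i) = \sum_i f i.
  by rewrite -(big_enum_val (A := I)).
have sumP (R : nzSemiRingType) (f : P -> R) : \sum_(i < #|P|) f (enum_val i) = \sum_i f i.
  by rewrite -(big_enum_val (A := P)).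
have [frA|nfrA] := boolP (row_free A).
  have [d d0 [n nE]] := fraction_clear (fun t : 'I_#|P| * 'I_#|I| => pinvmx A t.1 t.2).
  exists d => // C ev evd c cM [i0 ci0].
  pose B p i := n (enum_rank p, enum_rank i).
  have AB i i' : \sum_p M i p * B p i' = d *+ (i == i').
    apply/eqP; rewrite -tofrac_eq tofracMn rmorph_sum /=; apply/eqP.
    have := congr1 (fun B : 'M_#|I| => d%:F * B (enum_rank i) (enum_rank i')) (mulmxVp frA).
    rewrite /= !mxE (inj_eq enum_rank_inj) mulr_natr => <-; rewrite mulr_sumr -sumP.
    apply: eq_bigr => p _; rewrite /B enum_valK tofracM -nE /= mulrCA.
    by rewrite [A _ _]mxE !enum_rankK.
  case/negP: ci0; rewrite -(mulrI_eq0 _ (mulfI evd)); apply/eqP.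
  have <- : \sum_i \sum_p ev (B p i0) * (c i * ev (M i p)) = ev d * c i0.
    under eq_bigr => i _ do under eq_bigr => p _ do rewrite mulrC -mulrA -rmorphM.
    under eq_bigr => i _ do rewrite -mulr_sumr -rmorph_sum AB.
    rewrite (bigD1 i0) //= big1 ?addr0 => [|i /negPf->]; last by rewrite rmorph0 mulr0.
    by rewrite eqxx mulrC.
  rewrite exchange_big big1 // => p _ /=.
  by rewrite -mulr_sumr cM mulr0.
have /rowV0Pn[u /sub_kermxP uA u0] : kermx A != 0 by rewrite kermx_eq0.
have [d d0 [n nE]] := fraction_clear (fun t : 'I_#|I| => u 0 t).
have [i0 ni0] : exists i, n i != 0.
  have /rV0Pn[i ui] : u != 0 by []. 
  by exists i; rewrite -tofrac_eq0 -nE mulf_neq0 ?tofrac_eq0.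
exists (n i0) => // C ev evn c cM _; exists (fun i => n (enum_rank i)); last first.
  by exists (enum_val i0); rewrite enum_valK.
move=> p; apply/eqP; rewrite -tofrac_eq0 rmorph_sum /=; apply/eqP.
have := congr1 (fun B : 'rV_#|P| => d%:F * B 0 (enum_rank p)) uA.
rewrite /= !mxE mulr0 => uAp; rewrite -[RHS]uAp mulr_sumr.
apply: etrans (esym (sumI _ (fun i => (n (enum_rank i) * M i p)%:F))) _.
apply: eq_bigr => i _.
by rewrite enum_valK tofracM -nE -mulrA [A _ _]mxE !enum_rankK.
Qed.

End GenericKernel.

(** * Irreducible polynomials in two variables *)

Section Gauss.
Variable C : closedFieldType.
Implicit Types (f g h q : {poly {poly C}}) (c : {poly C}).

Definition constant2 g := exists c : C, g = c%:P%:P.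

Definition irreducible2 f :=
  ~ constant2 f /\ forall g h, f = g * h -> constant2 g \/ constant2 h.

(** The curve q = 0 contains the fibre Z = a as soon as q vanishes identically on
    it; in {poly {poly C}} the inner variable is Z and the outer one is W. *)
Lemma fibre_divides (a : C) q :
  map_poly (horner_eval a) q = 0 -> exists q1, q = ('X - a%:P) *: q1.
Proof.
move=> q0; exists (map_poly (fun c => c %/ ('X - a%:P)) q).
apply/polyP=> i; rewrite coefZ coef_map_id0 ?div0p //.
rewrite mulrC divpK // dvdp_XsubCl.
by rewrite rootE -[_.[a]]/(horner_eval a q`_i) -coef_map q0 coef0.
Qed.

(** Restriction to the fibre Z = a lands in the integral domain C[W]. *)
Lemma fibre_prime (a : C) f q h : ('X - a%:P) *: f = q * h ->
  (exists q1, q = ('X - a%:P) *: q1) \/ (exists h1, h = ('X - a%:P) *: h1).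
Proof.
move=> /(congr1 (map_poly (horner_eval a))).
rewrite map_polyZ rmorphM /= /horner_eval hornerXsubC subrr scale0r.
by move/esym/eqP; rewrite mulf_eq0 => /orP[] /eqP/fibre_divides; [left|right].
Qed.

(** Gauss's lemma: a factorization of f up to a factor c in C[Z] yields one of f,
    removing the linear factors of c one by one. *)
Lemma scalar_descent c f q h : c != 0 -> c *: f = q * h ->
  exists c1 c2 q' h',
    [/\ c1 != 0, c2 != 0, q = c1 *: q', h = c2 *: h' & f = q' * h'].
Proof.
elim: {c}(size c) {-2}c (leqnn (size c)) q h => [|n IHn] c szc q h c0 E.
  by move: c0; rewrite -size_poly_gt0 lt0n -leqn0 szc.
have [sz1|sz1] := leqP (size c) 1.
  have [k ck] : exists k, c = k%:P by exists c`_0; apply: size1_polyC.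
  have k0 : k != 0 by apply: contraNneq c0 => k0; rewrite ck k0.
  have kK : k%:P * k^-1%:P = 1 :> {poly C} by rewrite -polyCM mulfV.
  exists k%:P, 1, (k^-1%:P *: q), h; rewrite oner_neq0 -ck scale1r ck.
  by split; rewrite ?scalerA ?kK ?scale1r -?scalerAl -?E ?ck ?scalerA ?[_^-1%:P * _]mulrC ?kK ?scale1r -?ck.
have /closed_rootP[a /factor_theorem[c' c'E]] : size c != 1%N by rewrite gtn_eqF.
have X0 : 'X - a%:P != 0 by rewrite polyXsubC_eq0.
have c'0 : c' != 0 by apply: contraNneq c0 => c'0; rewrite c'E c'0 mul0r.
have szc' : (size c' <= n)%N.
  by move: szc; rewrite c'E size_Mmonic ?monicXsubC // size_XsubC addn2.
have can (u v : {poly {poly C}}) : ('X - a%:P) *: u = ('X - a%:P) *: v -> u = v.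
  by rewrite -!mul_polyC; apply: mulfI; rewrite polyC_eq0.
have E' : ('X - a%:P) *: (c' *: f) = q * h by rewrite scalerA mulrC -c'E.
have [[q1 q1E]|[h1 h1E]] := fibre_prime E'.
  have : c' *: f = q1 * h by apply: can; rewrite E' q1E -scalerAl.
  case/(IHn _ szc' _ _ c'0) => c1 [c2 [q' [h' [c10 c20 qE hE fE]]]].
  exists (('X - a%:P) * c1), c2, q', h'; split=> //; first by rewrite mulf_neq0.
  by rewrite q1E qE scalerA.
have : c' *: f = q * h1 by apply: can; rewrite E' h1E -scalerAr.
case/(IHn _ szc' _ _ c'0) => c1 [c2 [q' [h' [c10 c20 qE hE fE]]]].
exists c1, (('X - a%:P) * c2), q', h'; split=> //; first by rewrite mulf_neq0.
by rewrite h1E hE scalerA.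
Qed.

Lemma irreducible2_not_fibre f (a : C) f1 : irreducible2 f ->
  f = ('X - a%:P) *: f1 -> exists2 k : C, k != 0 & f = (k *: ('X - a%:P))%:P.
Proof.
move=> [fnc firr] fE; have := fE; rewrite -mul_polyC => /firr[[c]|[c cE]].
  by move/polyC_inj/(congr1 (size : {poly C} -> nat)); rewrite size_XsubC size_polyC; case: (c != 0).
exists c; last by rewrite fE cE -mul_polyC -polyCM mulrC mul_polyC.
by apply: contra_not_neq fnc => c0; exists 0; rewrite fE cE c0 scaler0.
Qed.

(** A vanishing resultant produces a common factor of f and g over C(Z). By
    [scalar_descent] the factor may be taken in C[Z][W]; irreducibility makes it
    equal to f up to a unit of C(Z), and a second descent gives divisibility in
    C[Z][W]. *)
Lemma irreducible2_dvd f g : irreducible2 f -> (1 < size f)%N ->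
  resultant f g = 0 -> exists q, g = q * f.
Proof.
move=> [fnc firr] szf /eqP; rewrite resultant_eq0 => szd.
set d := gcdp f g in szd.
have [[c0 q0] /= c00 E0] := Pdiv.Idomain.dvdpP _ _ (dvdp_gcdl f g).
have [[c1 q1] /= c10 E1] := Pdiv.Idomain.dvdpP _ _ (dvdp_gcdr f g).
have [a [b [q' [d' [a0 b0 _ dE fE]]]]] := scalar_descent c00 E0.
have [[k qk]|[k dk]] := firr _ _ fE; last first.
  by move: szd; rewrite /d dE dk size_scale // size_polyC; case: (_ != 0).
have E2 : c1 *: g = (q1 * (b *: (1 : {poly {poly C}}))) * d'.
  by rewrite E1 /= dE -!mulrA -scalerAl mul1r.
have k0 : k != 0.
  by apply: contra_not_neq fnc => k0; exists 0; rewrite fE qk k0 mul0r.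
have d'E : d' = k^-1%:P%:P * f.
  by rewrite fE qk mulrA -!polyCM mulVf // mul1r.
have [a1 [b1 [g' [d2 [a10 b10 _ d2E gE]]]]] := scalar_descent c10 E2.
have fE2 : f = (k *: b1)%:P * d2.
  by rewrite fE qk d2E mul_polyC -mul_polyC mul_polyC !mul_polyC scalerA mul_polyC.
have [[l lE]|[l lE]] := firr _ _ fE2; last first.
  by move: szf; rewrite fE d2E qk lE scale_polyC -polyCM size_polyC; case: (_ != 0).
have l0 : l != 0.
  by apply: contra_not_neq fnc => l0; exists 0; rewrite fE2 lE l0 mul0r.
exists (g' * l^-1%:P%:P).
by rewrite gE -mulrA fE2 lE; congr (_ * _); rewrite mulrA -!polyCM mulVf // mul1r.
Qed.

End Gauss.

(** * Resultants and the theorem of Bezout *)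

Section WeightedDeterminant.
Variables (C : fieldType) (n : nat) (A : 'M[{poly C}]_n).
Implicit Types rho gamma : 'I_n -> nat.

(** Multiplying row i by Z^(rho i) makes column j divisible by Z^(gamma j). *)
Lemma det_weight_dvd rho gamma m :
    (forall i j, 'X^(gamma j) %| 'X^(rho i) * A i j) ->
    (\sum_i rho i + m <= \sum_j gamma j)%N ->
  'X^m %| \det A.
Proof.
move=> dvdA le_rho; rewrite -(@dvdp_mul2l _ 'X^(\sum_i rho i)) ?monic_neq0 ?monicXn //.
rewrite -exprD; apply: dvdp_trans (dvdp_exp2l _ le_rho) _.
rewrite /determinant mulr_sumr.
apply: (big_ind (fun x => 'X^_ %| x)) => [|x y|s _]; [exact: dvdp0 | exact: dvdp_add |].
rewrite mulrCA dvdp_mull //.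
rewrite (reindex_inj (@perm_inj _ s)) /= -!prodrXr -big_split /=.
by apply: (big_ind2 (fun x y => x %| y)) => [|????|i _]; [exact: dvdpp | exact: dvdp_mul | exact: dvdA].
Qed.

(** The dual of [det_weight_dvd]: the same weights bound the degree of every term
    of the Leibniz expansion. *)
Lemma det_weight_size rho gamma m :
    (forall i j, A i j != 0 -> (size (A i j) + rho i <= (gamma j).+1)%N) ->
    (\sum_j gamma j <= \sum_i rho i + m)%N ->
  (size (\det A) <= m.+1)%N.
Proof.
move=> szA le_rho; rewrite /determinant; apply: (leq_trans (size_sum _ _ _)).
apply/bigmax_leqP => s _; rewrite size_Msign.
have [->|nz] := eqVneq (\prod_i A i (s i)) 0; first by rewrite size_poly0.
have nzA i : A i (s i) != 0 by move/prodf_neq0: nz; apply.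
rewrite size_prod // card_ord.
have : (\sum_i (size (A i (s i)) + rho i) <= \sum_i (gamma (s i)).+1)%N.
  by apply: leq_sum => i _; apply: szA.
rewrite big_split /=; under [in X in (_ <= X)%N -> _]eq_bigr do rewrite -addn1.
rewrite big_split /= sum1_card card_ord.
move: le_rho; rewrite (reindex_inj (@perm_inj _ s)) /= => le1 le2.
have := leq_trans le2 (leq_add le1 (leqnn n)).
by rewrite [X in (_ <= X)%N -> _]addnAC addnC -addnA leq_add2l leq_subLR addnS ltnS addnC.
Qed.

End WeightedDeterminant.

Section Sylvester.
Variable D : idomainType.
Implicit Types p q : {poly D}.

Definition band m n p : 'M[D]_(m, n) := lin1_mx (poly_rV \o p \o* rVpoly).
(** The Sylvester matrix with the dimensions as free parameters, so that the sizes
    of p and q may be rewritten. *)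
Definition sylvester m n p q : 'M[D]_(m + n) :=
  col_mx (band m (m + n) p) (band n (m + n) q).

Lemma resultantE p q :
  resultant p q = \det (sylvester (size q).-1 (size p).-1 p q).
Proof. by []. Qed.

Lemma bandE m n p i j : band m n p i j = p`_(j - i) *+ (i <= j).
Proof. by rewrite !mxE /= rVpoly_delta coefXnM ltnNge if_neg -mulrb. Qed.

Definition translation_mx n (w : D) : 'M[D]_n :=
  lin1_mx (poly_rV \o comp_poly ('X + w%:P) \o rVpoly).

Lemma size_translation p w : size (p \Po ('X + w%:P)) = size p.
Proof. by rewrite size_comp_poly2 // size_XaddC. Qed.

Lemma mul_translation_mx n (w : D) (u : 'rV_n) :
  u *m translation_mx n w = poly_rV (rVpoly u \Po ('X + w%:P)).
Proof. by rewrite mul_rV_lin1. Qed.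

Lemma translation_mx_unit n (w : D) : \det (translation_mx n w) \is a GRing.unit.
Proof.
have TK : translation_mx n w *m translation_mx n (- w) = 1%:M.
  apply/row_matrixP => i; rewrite !rowE mulmxA !mul_translation_mx mulmx1.
  rewrite poly_rV_K ?size_translation ?size_poly // -comp_polyA comp_polyD comp_polyX.
  by rewrite comp_polyC -addrA -polyCD addNr addr0 comp_polyXr rVpolyK.
by apply/unitrPr; exists (\det (translation_mx n (- w))); rewrite -det_mulmx TK det1.
Qed.

(** Translation of the variable is multiplicative: on vectors of coefficients,
    multiplying by the translate of p a translated polynomial is the same as
    translating its product by p. The bound on n ensures that no product is
    truncated. *)
Lemma translation_band m n p (w : D) : (0 < m -> m + (size p).-1 <= n)%N ->
  translation_mx m w *m band m n (p \Po ('X + w%:P)) = band m n p *m translation_mx n w.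
Proof.
move=> le_n; apply/row_matrixP => i; rewrite !rowE !mulmxA mul_translation_mx.
have m0 : (0 < m)%N by case: (m) i => [[]|].
have {}le_n := le_n m0.
have szi : (size (rVpoly (delta_mx 0%R i : 'rV[D]_m)) <= m)%N by apply: size_poly.
rewrite ![_ *m band _ _ _]mul_rV_lin1 /= mul_translation_mx !poly_rV_K ?size_translation //.
  by rewrite comp_polyM.
by apply: leq_trans (size_polyMleq _ _) _; lia.
Qed.

(** Conjugation of the Sylvester matrix by translations, whose determinants are
    units since translations are invertible. *)
Lemma resultant_translation p q (w : D) :
  exists2 u, u \is a GRing.unit &
    resultant (p \Po ('X + w%:P)) (q \Po ('X + w%:P)) = u * resultant p q.
Proof.
set tau := 'X + w%:P.
pose m := (size q).-1; pose n := (size p).-1.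
have E : block_mx (translation_mx m w) 0 0 (translation_mx n w) *m
    sylvester m n (p \Po tau) (q \Po tau) = sylvester m n p q *m translation_mx _ w.
  rewrite /sylvester mul_block_col !mul0mx addr0 add0r mul_col_mx.
  by congr col_mx; apply: translation_band; rewrite ?leqnn // addnC.
move/(congr1 determinant): E; rewrite !det_mulmx det_ublock !resultantE.
rewrite !size_translation -/m -/n => E.
have Um := translation_mx_unit m w; have Un := translation_mx_unit n w.
have Umn := translation_mx_unit (m + n) w.
exists ((\det (translation_mx m w) * \det (translation_mx n w))^-1 *
  \det (translation_mx (m + n) w)); first by rewrite unitrM unitrV unitrM Um Un.
by rewrite -mulrA [X in _ * X]mulrC -E mulKr // unitrM Um Un.
Qed.

End Sylvester.

Section LocalOrder.
Variable C : fieldType.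
Implicit Types f g p q : {poly {poly C}}.

(** The excess of the column weights over the row weights in [order_resultant]. It
    stays at least m k even when b < k, provided that m <= a. *)
Lemma order_sum m k a b : (m <= a)%N ->
  (\sum_(i < b) (k - i) + \sum_(i < a) (m - i) + m * k <= \sum_(i < b + a) (m + k - i))%N.
Proof.
move=> le_ma; rewrite -(subnKC le_ma); move: (a - m)%N => t {a le_ma}.
rewrite (addnC b) big_split_ord -(addnA m t b) (addnC t b) [X in (_ <= X)%N]big_split_ord /=.
have -> : (\sum_(i < t) (m - (m + i)) = 0)%N by apply: big1 => i _; lia.
have -> : (\sum_(i < m) (m + k - i) = \sum_(i < m) (m - i) + m * k)%N.
  have <- : (\sum_(i < m) k = m * k)%N by rewrite sum_nat_const card_ord.
  rewrite -big_split /=.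
  by apply: eq_bigr => i _; have := ltn_ord i; lia.
under [X in (_ <= _ + X)%N]eq_bigr do rewrite subnDl.
rewrite [X in (_ <= _ + X)%N]big_split_ord /=; lia.
Qed.

(** Multiplying the row of W^i p by Z^(k - i) and that of W^i q by Z^(m - i) makes
    column j divisible by Z^(m + k - j). *)
Lemma order_resultant p q m k :
    (m <= (size p).-1)%N ->
    (forall b, 'X^(m - b) %| p`_b) -> (forall b, 'X^(k - b) %| q`_b) ->
  'X^(m * k) %| resultant p q.
Proof.
move=> le_m dp dq; rewrite resultantE.
pose rho (i : 'I_((size q).-1 + (size p).-1)) :=
  (match split i with inl i => k - i | inr i => m - i end)%N.
apply: (@det_weight_dvd _ _ _ rho (fun j => m + k - j)%N).
  move=> i j; rewrite /rho /sylvester mxE; case: (split i) => i'; rewrite bandE.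
    case: leqP => [le_ij|_]; last by rewrite mulr0 dvdp0.
    have := dvdp_mul (dvdpp 'X^(k - i')) (dp (j - i')%N); rewrite -exprD.
    by apply: dvdp_trans; apply: dvdp_exp2l; move: le_ij; move: (i' : nat) (j : nat) => x y; lia.
  case: leqP => [le_ij|_]; last by rewrite mulr0 dvdp0.
  have := dvdp_mul (dvdpp 'X^(m - i')) (dq (j - i')%N); rewrite -exprD.
  by apply: dvdp_trans; apply: dvdp_exp2l; move: le_ij; move: (i' : nat) (j : nat) => x y; lia.
apply: leq_trans (order_sum _ _ le_m); rewrite leq_add2r big_split_ord /=.
rewrite leq_eqVlt; apply/orP; left; apply/eqP; congr addn; apply: eq_bigr => i _.
  by rewrite /rho; case: split_ordP => j /eqP; rewrite ?eq_lshift ?eq_lrshift ?eq_rlshift // => /eqP<-.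
by rewrite /rho; case: split_ordP => j /eqP; rewrite ?eq_rshift ?eq_lrshift ?eq_rlshift // => /eqP<-.
Qed.

Definition shift (z w : C) f : {poly {poly C}} :=
  map_poly (comp_poly ('X + z%:P)) f \Po ('X + w%:P%:P).

(** Multiplicity at least k at the point (z, w). *)
Definition vanishes (k : nat) (z w : C) f :=
  forall a b, (a + b < k)%N -> (shift z w f)`_b`_a = 0.

Lemma vanishes_dvd k z w f b : vanishes k z w f -> 'X^(k - b) %| (shift z w f)`_b.
Proof.
move=> van; apply/dvdpP; exists (drop_poly (k - b) (shift z w f)`_b).
rewrite -[LHS](poly_take_drop (k - b)) (_ : take_poly _ _ = 0) ?add0r //.
by apply/polyP=> a; rewrite coef_take_poly coef0; case: ltnP => // lt_a; apply: van; lia.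
Qed.

End LocalOrder.

Section Bezout.
Variable C : closedFieldType.
Implicit Types f g : {poly {poly C}}.

Lemma comp_XaddC_inj (z : C) : injective (comp_poly ('X + z%:P)).
Proof.
apply: raddf_inj => p /(congr1 (fun p : {poly C} => size p)).
by rewrite size_translation size_poly0 => /eqP; rewrite size_poly_eq0 => /eqP.
Qed.

Lemma size_shift (z w : C) f : size (shift z w f) = size f.
Proof.
by rewrite size_translation size_map_inj_poly ?comp_poly0 //; apply: comp_XaddC_inj.
Qed.

(** The restriction of f to the fibre Z = z is a nonzero polynomial in W that
    vanishes to order at least m at w. *)
Lemma multiplicity_le_degree (z w : C) m f :
    vanishes m z w f -> (forall f1, f <> ('X - z%:P) *: f1) ->
  (m <= (size f).-1)%N.
Proof.
move=> van nfib.
have nz : map_poly (horner_eval 0) (shift z w f) != 0.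
  rewrite map_comp_poly -map_poly_comp rmorphD /= map_polyX map_polyC /=.
  rewrite /horner_eval hornerC -size_poly_eq0 size_translation size_poly_eq0.
  rewrite (_ : map_poly _ f = map_poly (horner_eval z) f).
    by apply/eqP => /fibre_divides[f1]; apply: nfib.
  apply/polyP=> i; rewrite !coef_map_id0 ?rmorph0 //= ?comp_poly0 ?horner0 //.
  by rewrite /horner_eval horner_comp hornerD hornerX hornerC add0r.
have : lead_coef (map_poly (horner_eval 0) (shift z w f)) != 0 by rewrite lead_coef_eq0.
rewrite lead_coefE coef_map /= /horner_eval horner_coef0.
set b := (size _).-1 => nzb.
have le_b : (b <= (size f).-1)%N.
  by rewrite /b -(size_shift z w f) -!subn1 leq_sub2r // size_poly.
apply: leq_trans le_b; rewrite leqNgt; apply: contraNN nzb => lt_b.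
by rewrite van.
Qed.

Lemma resultant_local (z w : C) m k f g :
    vanishes m z w f -> vanishes k z w g -> f != 0 -> g != 0 ->
    (forall f1, f <> ('X - z%:P) *: f1) ->
  ('X - z%:P) ^+ (m * k) %| resultant f g.
Proof.
move=> vf vg f0 g0 nfib.
have le_m := multiplicity_le_degree vf nfib.
have := order_resultant _ (fun b => vanishes_dvd b vf) (fun b => vanishes_dvd b vg).
rewrite size_shift => /(_ le_m); rewrite /shift.
set th := comp_poly ('X + z%:P).
have [u Uu ->] := resultant_translation (map_poly th f) (map_poly th g) w%:P.
have th0 (h : {poly {poly C}}) : h != 0 -> th (lead_coef h) != 0.
  by move=> h0; rewrite -(rmorph0 th) (inj_eq (@comp_XaddC_inj z)) lead_coef_eq0.
rewrite -(map_resultant (f := th)) ?th0 // => /(dvdp_mull u^-1); rewrite mulKr //.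
move/(dvdp_comp_poly ('X - z%:P)).
rewrite /th -comp_polyA comp_polyD comp_polyX comp_polyC subrK comp_polyXr.
by rewrite comp_Xn_poly.
Qed.

(** The Newton polygon of the sections of al C0 + (e al + d) f in the chart
    s = u = 1, where t becomes Z and v becomes W. *)
Definition trapezoid (e al d : nat) f :=
  (size f <= al.+1)%N /\ forall l, (size (f`_l)%R <= (d + e * l).+1)%N.

(** The bound is the self-intersection of the class of the trapezoid. The entry in
    column j of the row of W^i f has degree at most d + e (j - i). *)
Lemma size_resultant e al d f g : trapezoid e al d f -> trapezoid e al d g ->
  (size (resultant f g) <= (al * (d + d + e * al)).+1)%N.
Proof.
move=> [szf wf] [szg wg]; rewrite resultantE.
pose rho (i : 'I_((size g).-1 + (size f).-1)) :=
  (e * match split i with inl i => i | inr i => i end)%N.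
apply: (@det_weight_size _ _ _ rho (fun j => d + e * j)%N).
  move=> i j; rewrite /rho /sylvester mxE; case: (split i) => i'; rewrite bandE.
    case: leqP => [le_ij _|_]; last by rewrite eqxx.
    apply: leq_trans (leq_add (wf _) (leqnn _)) _; move: le_ij.
    by move: (i' : nat) (j : nat) => x y; nia.
  case: leqP => [le_ij _|_]; last by rewrite eqxx.
  apply: leq_trans (leq_add (wg _) (leqnn _)) _; move: le_ij.
  by move: (i' : nat) (j : nat) => x y; nia.
have -> : (\sum_i rho i = e * (\sum_(i < (size g).-1) i + \sum_(i < (size f).-1) i))%N.
  rewrite /rho -big_distrr /= big_split_ord /=; congr (_ * (_ + _))%N; apply: eq_bigr => i _.
    by case: split_ordP => j /eqP; rewrite ?eq_lshift ?eq_lrshift ?eq_rlshift // => /eqP<-.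
  by case: split_ordP => j /eqP; rewrite ?eq_rshift ?eq_lrshift ?eq_rlshift // => /eqP<-.
rewrite big_split /= sum_nat_const card_ord -big_distrr /= big_split_ord /=.
rewrite big_split /= sum_nat_const card_ord.
have le1 : ((size g).-1 <= al)%N by lia.
have le2 : ((size f).-1 <= al)%N by lia.
move: (\sum_(i < _) i)%N (\sum_(i < _) i)%N le1 le2 => x y.
move: (size f).-1 (size g).-1 => a b le1 le2.
have : ((b + a) * d <= al * (d + d))%N by nia.
have : (a * b <= al * al)%N by rewrite leq_mul.
nia.
Qed.

(** The intersection number of two curves of the same class, the first one
    irreducible and not a component of the second, bounds the sum of the local
    contributions m_i k_i. Distinct z_i keep these contributions apart: they are
    orders of the resultant at distinct points of the line. *)
Lemma bezout r (z w : 'I_r -> C) (m k : 'I_r -> nat) e al d f g :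
    injective z -> irreducible2 f -> (1 < size f)%N ->
    trapezoid e al d f -> trapezoid e al d g ->
    (forall i, vanishes (m i) (z i) (w i) f) ->
    (forall i, vanishes (k i) (z i) (w i) g) ->
    (forall q, g <> q * f) ->
  (\sum_i m i * k i <= al * (d + d + e * al))%N.
Proof.
move=> z_inj irrf szf tf tg vf vg ndvd.
have f0 : f != 0 by rewrite -size_poly_gt0 ltnW.
have g0 : g != 0 by apply/eqP => g0; apply: (ndvd 0); rewrite mul0r.
have res0 : resultant f g != 0.
  by apply/eqP => /(irreducible2_dvd irrf szf)[q]; apply: ndvd.
have nfib a f1 : f <> ('X - a%:P) *: f1.
  case/(irreducible2_not_fibre irrf) => k' _ fE; move: szf; rewrite fE size_polyC.
  by case: (_ != 0).
have dvd : \prod_i ('X - (z i)%:P) ^+ (m i * k i) %| resultant f g.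
  have : uniq (index_enum 'I_r) by apply: index_enum_uniq.
  elim: (index_enum _) => [|i s IHs] /=; first by rewrite big_nil dvd1p.
  case/andP=> nis /IHs dvds; rewrite big_cons Gauss_dvdp.
    by rewrite dvds andbT (resultant_local (vf i) (vg i)).
  apply: coprimep_expl; elim: s nis {IHs dvds} => [|j s IHs]; first by rewrite big_nil coprimep1.
  rewrite inE negb_or big_cons coprimepMr => /andP[nij /IHs->]; rewrite andbT.
  have : coprimep ('X - (z i)%:P) ('X - (z j)%:P).
    by rewrite coprimep_XsubC rootE hornerXsubC subr_eq0 (inj_eq z_inj) eq_sym.
  by move/(coprimep_expr (m j * k j)).
have := dvdp_leq res0 dvd.
rewrite size_prod => [|i _]; last by rewrite expf_neq0 // polyXsubC_eq0.
under eq_bigr do rewrite size_exp_XsubC -addn1.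
rewrite big_split /= sum1_card card_ord -addnS addnC.
have := size_resultant tf tg.
move: (\sum_i _)%N (size _) => x y; lia.
Qed.

End Bezout.

(** * Sections moving with the points *)

Section Trapezoid.
Variables (C : closedFieldType) (e al d : nat).

(** A dependent pair (l, j) stands for the monomial Z^j W^l. *)
Definition lattice_points := {l : 'I_al.+1 & 'I_(d + e * l).+1}.
Implicit Types c : lattice_points -> C.

Definition spread c : {poly {poly C}} :=
  \sum_p (c p *: 'X^(tagged p)) *: 'X^(tag p).

Lemma coef_spread c (p : lattice_points) : (spread c)`_(tag p)`_(tagged p) = c p.
Proof.
rewrite /spread !coef_sum (bigD1 p) //= !coefZ coefXn eqxx mulr1 coefZ coefXn eqxx mulr1.
rewrite big1 ?addr0 // => q nqp; rewrite coefZ coefXn; case: eqP => [tpq|_]; last by rewrite mulr0 coef0.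
rewrite mulr1 coefZ coefXn; case: eqP => [tdpq|_]; last by rewrite mulr0.
case/eqP: nqp; move: p q tpq tdpq => [l j] [l' j'] /= /val_inj El; case: _ / El j' => j' /val_inj->.
by [].
Qed.

Lemma trapezoid_spread c : trapezoid e al d (spread c).
Proof.
split=> [|l].
  apply/leq_sizeP => l le_l; rewrite coef_sum big1 // => p _.
  by rewrite coefZ coefXn gtn_eqF ?mulr0 // (leq_trans (ltn_ord _)).
apply/leq_sizeP => j le_j; rewrite !coef_sum big1 // => p _.
rewrite coefZ coefXn; case: eqP => [lp|_]; last by rewrite mulr0 coef0.
rewrite mulr1 coefZ coefXn gtn_eqF ?mulr0 //; apply: leq_trans (ltn_ord _) _.
by rewrite -lp.
Qed.

Lemma trapezoidP f : trapezoid e al d f ->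
  f = spread (fun p => f`_(tag p)`_(tagged p)).
Proof.
move=> tf; have [szf wf] := tf; set c := fun p : lattice_points => _.
have [szs ws] := trapezoid_spread c.
apply/polyP=> l; have [lt_l|le_l] := ltnP l al.+1; last first.
  by rewrite !nth_default ?(leq_trans szf le_l) ?(leq_trans szs le_l).
apply/polyP=> j; have [lt_j|le_j] := ltnP j (d + e * l).+1; last first.
  by rewrite [LHS]nth_default ?(leq_trans (wf l)) // [RHS]nth_default ?(leq_trans (ws l)).
by rewrite (coef_spread c (Tagged (fun l : 'I_al.+1 => 'I_(d + e * l).+1) (i := Ordinal lt_l) (Ordinal lt_j))).
Qed.

Lemma card_lattice_points : (#|{: lattice_points}| = al.+1 * d.+1 + e * \sum_(l < al.+1) l)%N.
Proof.
rewrite card_tagged sumnE big_map big_enum /=.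
under eq_bigr do rewrite card_ord -addSn.
by rewrite big_split /= sum_nat_const card_ord big_distrr.
Qed.

End Trapezoid.

Section Moving.
Variables (C : numClosedFieldType) (r e al d : nat).
Local Notation D := {mpoly C[r + r]}.
Local Notation points := (lattice_points e al d).
Implicit Types (v : points -> D) (y : 'I_(r + r) -> C) (i : 'I_r).

(** The coefficient of Z^a W^b in the expansion of the monomial p at the i-th point,
    as a polynomial in the coordinates of all the points: z_i is the variable
    lshift r i and w_i the variable rshift r i. *)
Definition taylor_monomial (p : points) i a b : D :=
  ('X_(lshift r i) ^+ (tagged p - a) *+ 'C(tagged p, a)) *
  ('X_(rshift r i) ^+ (tag p - b) *+ 'C(tag p, b)).

Definition taylor v i a b : D := \sum_p v p * taylor_monomial p i a b.

Lemma coef_XaddC_exp (A : comNzRingType) (c : A) n k :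
  (('X + c%:P) ^+ n)`_k = c ^+ (n - k) *+ 'C(n, k).
Proof.
rewrite addrC exprDn (eq_bigr (fun h : 'I_n.+1 => (c ^+ (n - h) *+ 'C(n, h)) *: 'X^h)).
  rewrite -(poly_def _ (fun h => c ^+ (n - h) *+ 'C(n, h))) coef_poly ltnS.
  by case: leqP => // lt_nk; rewrite bin_small.
by move=> h _; rewrite -polyC_exp mul_polyC scalerMnl.
Qed.

Lemma eval_taylor v y i a b :
  (taylor v i a b).@[y] =
  (shift (y (lshift r i)) (y (rshift r i)) (spread (fun p => (v p).@[y])))`_b`_a.
Proof.
rewrite /taylor /spread /shift rmorph_sum /= !(rmorph_sum, raddf_sum) /= !coef_sum.
apply: eq_bigr => p _.
rewrite !map_polyZ map_polyXn /= comp_polyZ comp_Xn_poly coefZ coef_XaddC_exp.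
rewrite comp_polyZ comp_Xn_poly -polyC_exp -polyCMn coefMC coefZ.
rewrite coef_XaddC_exp mevalM /taylor_monomial mevalM !mevalMn !rmorphXn /= !mevalXU.
by rewrite mulrA.
Qed.

Lemma coef_shift_spread (c : points -> C) y i a b :
  (shift (y (lshift r i)) (y (rshift r i)) (spread c))`_b`_a =
  \sum_p c p * (taylor_monomial p i a b).@[y].
Proof.
have := eval_taylor (fun p => (c p)%:MP) y i a b.
rewrite (_ : spread (fun p => _) = spread c); last by apply: eq_bigr => p _; rewrite mevalC.
by move=> <-; rewrite /taylor rmorph_sum; apply: eq_bigr => p _; rewrite /= mevalM mevalC.
Qed.

(** One column for each condition of vanishing to order m i at the i-th point. The
    finite range of (a, b) is too large, and the excess columns are zero. *)
Definition taylor_column (m : 'I_r -> nat) (p : points)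
    (t : 'I_r * 'I_(\max_i m i) * 'I_(\max_i m i)) : D :=
  if (t.1.2 + t.2 < m t.1.1)%N then taylor_monomial p t.1.1 t.1.2 t.2 else 0.

(** At a point y outside a hypersurface, a section with multiplicities m can only
    exist if there is one whose coefficients are polynomial functions of the
    points. *)
Lemma generic_section (m : 'I_r -> nat) :
  exists2 g : D, g != 0 & forall y, g.@[y] != 0 -> forall f, f != 0 ->
    trapezoid e al d f ->
    (forall i, vanishes (m i) (y (lshift r i)) (y (rshift r i)) f) ->
  exists2 v, forall i a b, (a + b < m i)%N -> taylor v i a b = 0 &
    spread (fun p => (v p).@[y]) != 0.
Proof.
have [g g0 gP] := generic_kernel (taylor_column (m := m)).
exists g => // y gy f f0 tf vf.
have fE := trapezoidP tf; set c := fun p => _ in fE.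
have c_nz : exists p, c p != 0.
  apply/existsP; apply: contraNT f0 => /existsPn c0; rewrite fE /spread big1 // => p _.
  by have /negPn/eqP-> := c0 p; rewrite !scale0r.
have [|v vP [p vp]] := gP _ (meval y) gy c _ c_nz.
  move=> [[i a] b]; rewrite /taylor_column /=.
  case: ltnP => [ab|_]; last by rewrite big1 // => p _; rewrite rmorph0 mulr0.
  rewrite -[RHS](vf i a b ab) fE.
  by rewrite coef_shift_spread.
exists v.
  move=> i a b ab.
  have lt_a : (a < \max_i m i)%N by apply: leq_trans (leq_bigmax i); lia.
  have lt_b : (b < \max_i m i)%N by apply: leq_trans (leq_bigmax i); lia.
  rewrite -[RHS](vP (i, Ordinal lt_a, Ordinal lt_b)); apply: eq_bigr => p' _.
  by rewrite /taylor_column /= ab.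
apply: contraNneq vp => sp0.
by apply/eqP/(etrans (esym (coef_spread (fun p => (v p).@[y]) p))); rewrite sp0 !coef0.
Qed.

Lemma mderiv_Xn (k : 'I_(r + r)) n q :
  mderiv q ('X_k ^+ n : D) = if k == q then 'X_k ^+ n.-1 *+ n else 0.
Proof.
elim: n => [|n IHn]; first by rewrite expr0 mulr0n -mpolyC1 mderivC if_same.
rewrite exprS mderivM IHn mderivX mnm1E; case: eqP => [->|_]; last first.
  by rewrite mulr0 scale0r mul0r addr0.
rewrite -{1}[U_(q)%MM]add0m addmK mpolyX0 scale1r mul1r mulrnAr -exprS.
by case: n {IHn} => [|n]; rewrite ?mulr0n ?addr0 ?expr0 //= -mulrS.
Qed.

(** Moving z_{i0} acts on Taylor expansions at the i0-th point as differentiation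
    in Z, and does not affect those at the other points. *)
Lemma mderiv_monomial_fibre i i0 (p : points) a b :
  mderiv (lshift r i0) (taylor_monomial p i a b) =
  (taylor_monomial p i a.+1 b *+ a.+1) *+ (i == i0).
Proof.
rewrite /taylor_monomial mderivM !mderivMn !mderiv_Xn eq_lshift eq_rlshift.
rewrite mul0rn mulr0 addr0; case: (i == i0); last by rewrite mul0rn mul0r.
rewrite mulr1n -[in RHS]mulrnAl -!mulrnA.
by rewrite [('C(_, _.+1) * _)%N]mulnC mul_bin_left subnS.
Qed.

Lemma mderiv_monomial_section i i0 (p : points) a b :
  mderiv (rshift r i0) (taylor_monomial p i a b) =
  (taylor_monomial p i a b.+1 *+ b.+1) *+ (i == i0).
Proof.
rewrite /taylor_monomial mderivM !mderivMn !mderiv_Xn eq_rshift eq_lrshift.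
rewrite mul0rn mul0r add0r; case: (i == i0); last by rewrite mul0rn mulr0.
rewrite mulr1n -[in RHS]mulrnAr -!mulrnA.
by rewrite [('C(_, _.+1) * _)%N]mulnC mul_bin_left subnS.
Qed.

Lemma mderiv_taylor_fibre v i i0 a b :
  mderiv (lshift r i0) (taylor v i a b) =
  taylor (fun p => mderiv (lshift r i0) (v p)) i a b +
  (taylor v i a.+1 b *+ a.+1) *+ (i == i0).
Proof.
rewrite /taylor raddf_sum -!sumrMnl -big_split; apply: eq_bigr => p _.
by rewrite /= mderivM mderiv_monomial_fibre !mulrnAr.
Qed.

Lemma mderiv_taylor_section v i i0 a b :
  mderiv (rshift r i0) (taylor v i a b) =
  taylor (fun p => mderiv (rshift r i0) (v p)) i a b +
  (taylor v i a b.+1 *+ b.+1) *+ (i == i0).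
Proof.
rewrite /taylor raddf_sum -!sumrMnl -big_split; apply: eq_bigr => p _.
by rewrite /= mderivM mderiv_monomial_section !mulrnAr.
Qed.

(** Differentiate the identities taylor v i a b = 0. At the points i <> j nothing is
    lost. At the point j the derivative of v has, up to sign, the Taylor
    coefficients of the derivative of the section: the order drops by one, and
    drops exactly, in the direction of a nonzero coefficient of degree m j. *)
Lemma derived_section v y (m : 'I_r -> nat) j a b :
    (forall i a b, (a + b < m i)%N -> taylor v i a b = 0) ->
    (a + b = m j)%N -> (0 < m j)%N -> (taylor v j a b).@[y] != 0 ->
  exists g, [/\ trapezoid e al d g,
    forall i, vanishes (m i - (i == j)) (y (lshift r i)) (y (rshift r i)) g &
    ~ vanishes (m j) (y (lshift r j)) (y (rshift r j)) g].
Proof.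
move=> v0 abm m0 vab.
suff [q [a' [b' [lt_ab nz vq]]]] : exists q a' b', [/\ (a' + b' < m j)%N,
    (taylor (fun p => mderiv q (v p)) j a' b').@[y] != 0 &
    forall i a b, (a + b < m i - (i == j))%N -> taylor (fun p => mderiv q (v p)) i a b = 0].
  exists (spread (fun p => (mderiv q (v p)).@[y])); split.
  - exact: trapezoid_spread.
  - by move=> i a1 b1 ab1; rewrite -eval_taylor vq // meval0.
  - by move/(_ a' b' lt_ab)/eqP; rewrite -eval_taylor (negPf nz).
case: a abm vab => [|a] abm vab.
  case: b abm vab => [|b] abm vab; first by rewrite -abm in m0.
  have D0 i a1 b1 : (a1 + b1 < m i)%N -> taylor (fun p => mderiv (rshift r j) (v p)) i a1 b1 =
      - (taylor v i a1 b1.+1 *+ b1.+1) *+ (i == j).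
    move=> ab1; have := mderiv_taylor_section v i j a1 b1.
    by rewrite v0 // mderiv0 => /esym/eqP; rewrite addr_eq0 mulNrn => /eqP.
  exists (rshift r j), 0%N, b; split=> [||i a1 b1 ab1].
  - by rewrite -abm.
  - rewrite D0 -?abm // eqxx mulr1n mevalN oppr_eq0 mevalMn mulrn_eq0 /=.
    exact: vab.
  - rewrite D0; last by move: ab1; case: eqP; lia.
    by move: ab1; case: eqP => [->|_] ab1; rewrite ?mulr0n // v0 ?mul0rn ?oppr0 ?mul0rn //; lia.
have D0 i a1 b1 : (a1 + b1 < m i)%N -> taylor (fun p => mderiv (lshift r j) (v p)) i a1 b1 =
    - (taylor v i a1.+1 b1 *+ a1.+1) *+ (i == j).
  move=> ab1; have := mderiv_taylor_fibre v i j a1 b1.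
  by rewrite v0 // mderiv0 => /esym/eqP; rewrite addr_eq0 mulNrn => /eqP.
exists (lshift r j), a, b; split=> [||i a1 b1 ab1].
- by rewrite -abm.
- rewrite D0 -?abm // eqxx mulr1n mevalN oppr_eq0 mevalMn mulrn_eq0 /=.
  exact: vab.
- rewrite D0; last by move: ab1; case: eqP; lia.
  by move: ab1; case: eqP => [->|_] ab1; rewrite ?mulr0n // v0 ?mul0rn ?oppr0 ?mul0rn //; lia.
Qed.

(** The hypothesis on products q * f says that the trapezoid is the smallest one of
    its shape that contains f. In the second case g is not proportional to f
    because its multiplicity at the point j is too small. *)
Lemma self_intersection_bound y (m : 'I_r -> nat) f v j :
    injective (fun i => y (lshift r i)) -> irreducible2 f -> (1 < size f)%N ->
    trapezoid e al d f ->
    (forall g q, trapezoid e al d g -> g = q * f -> exists c : C, g = c%:P%:P * f) ->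
    (forall i, vanishes (m i) (y (lshift r i)) (y (rshift r i)) f) ->
    (0 < m j)%N -> ~ vanishes (m j).+1 (y (lshift r j)) (y (rshift r j)) f ->
    (forall i a b, (a + b < m i)%N -> taylor v i a b = 0) ->
    spread (fun p => (v p).@[y]) != 0 ->
  (\sum_i m i * m i <= al * (d + d + e * al))%N \/
  (\sum_i m i * (m i - (i == j)) <= al * (d + d + e * al))%N /\
  exists g, [/\ trapezoid e al d g,
    forall i, vanishes (m i - (i == j)) (y (lshift r i)) (y (rshift r i)) g &
    ~ vanishes (m j) (y (lshift r j)) (y (rshift r j)) g].
Proof.
move=> z_inj irrf szf tf exf vf m0 nvf v0; set f0 := spread _ => f00.
have tf0 : trapezoid e al d f0 by apply: trapezoid_spread.
have vf0 i : vanishes (m i) (y (lshift r i)) (y (rshift r i)) f0.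
  by move=> a b ab; rewrite -eval_taylor v0 // meval0.
have [[q f0E]|ndvd] := boolp.pselect (exists q, f0 = q * f); last first.
  left; apply: (bezout z_inj irrf szf tf tf0 vf vf0) => q f0E.
  by apply: ndvd; exists q.
right; have [c {}f0E] := exf _ _ tf0 f0E.
have scale (k : C) (z w : C) h a b : (shift z w (k%:P%:P * h))`_b`_a = k * (shift z w h)`_b`_a.
  rewrite /shift rmorphM /= map_polyC /= comp_polyC comp_polyM comp_polyC.
  by rewrite coefCM coefCM.
have [a [b [ab vab]]] : exists a b, (a + b = m j)%N /\ (taylor v j a b).@[y] != 0.
  apply: boolp.contrapT => nab; apply: nvf => a b; rewrite ltnS leq_eqVlt => /predU1P[ab|]; last exact: vf.
  have c0 : c != 0 by apply: contraNneq f00 => c0; rewrite f0E c0 mul0r.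
  apply: (mulfI c0); rewrite mulr0 -scale -f0E -eval_taylor; apply/eqP/negPn/negP => ne.
  by apply: nab; exists a, b.
have [g [tg vg nvg]] := derived_section v0 ab m0 vab.
split; last by exists g.
apply: (bezout z_inj irrf szf tf tg vf vg) => q' gE.
have [k {}gE] := exf _ _ tg gE.
by apply: nvg => a1 b1 ab1; rewrite gE scale vf // mulr0.
Qed.

(** Evaluation at the r points is onto, because g j vanishes at all of them but the
    j-th, and it has f in its kernel. *)
Lemma independent_sections y (f : {poly {poly C}}) (g : 'I_r -> {poly {poly C}}) : f != 0 ->
    trapezoid e al d f -> (forall j, trapezoid e al d (g j)) ->
    (forall i, vanishes 1 (y (lshift r i)) (y (rshift r i)) f) ->
    (forall i j, i != j -> vanishes 1 (y (lshift r i)) (y (rshift r i)) (g j)) ->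
    (forall j, ~ vanishes 1 (y (lshift r j)) (y (rshift r j)) (g j)) ->
  (r < #|{: points}|)%N.
Proof.
move=> f0 tf tg vf vg nvg.
pose M : 'M[C]_(#|{: points}|, r) := \matrix_(k, i) (taylor_monomial (enum_val k) i 0 0).@[y].
pose coefs (h : {poly {poly C}}) : 'rV_#|{: points}| :=
  \row_k (fun p : points => h`_(tag p)`_(tagged p)) (enum_val k).
have coefsM h i : trapezoid e al d h ->
    (coefs h *m M) 0 i = (shift (y (lshift r i)) (y (rshift r i)) h)`_0`_0.
  move=> th; rewrite {2}(trapezoidP th) coef_shift_spread mxE.
  rewrite [RHS](big_enum_val (A := {: points})); by apply: eq_bigr => k _; rewrite !mxE.
have coefs0 h : trapezoid e al d h -> coefs h = 0 -> h = 0.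
  move=> th /rowP h0; rewrite (trapezoidP th) /spread big1 // => p _.
  by have := h0 (enum_rank p); rewrite !mxE enum_rankK => ->; rewrite !scale0r.
have van0 (h : {poly {poly C}}) z w : (shift z w h)`_0`_0 = 0 -> vanishes 1 z w h.
  by move=> h0 a b; rewrite ltnS leqn0 addn_eq0 => /andP[/eqP-> /eqP->].
have rankM : (r <= \rank M)%N.
  pose B : 'M_(r, #|{: points}|) := \matrix_j coefs (g j).
  have BM : B *m M = diag_mx (\row_j (coefs (g j) *m M) 0 j).
    apply/matrixP => j i; rewrite [RHS]mxE [(\row__ _) _ _]mxE.
    have -> : (B *m M) j i = (coefs (g j) *m M) 0 i.
      by rewrite !mxE; apply: eq_bigr => k _; rewrite !mxE.
    by case: eqP => [->|/eqP]; rewrite ?mulr1n ?coefsM // eq_sym => ij; rewrite vg ?mulr0n.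
  have BMu : B *m M \in unitmx.
    rewrite BM unitmxE det_diag unitfE; apply/prodf_neq0 => j _.
    by rewrite mxE coefsM //; apply/eqP => /van0; apply: nvg.
  by have := mxrankM_maxr B M; rewrite (mxrank_unit BMu).
have : (0 < \rank (kermx M))%N.
  rewrite lt0n mxrank_eq0; apply: contra_neq f0 => kM0; apply: coefs0 => //.
  apply/eqP; rewrite -submx0 -kM0; apply/sub_kermxP/rowP => i.
  by rewrite coefsM // vf // mxE.
by rewrite mxrank_ker subn_gt0; apply: leq_ltn_trans.
Qed.

End Moving.

(** * Homogeneous coordinates and the affine chart *)

Section Variables.
Variables (K : fieldType) (n : nat).
Implicit Types (F G H : {mpoly K[n]}) (i : 'I_n).

Lemma mpoly_unitP F : F \is a GRing.unit -> exists2 c, c != 0 & F = c%:MP.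
Proof.
by move=> /andP[/eqP FE]; rewrite unitfE => c0; exists F@_0.
Qed.

Lemma mpolyX_nunit i : ('X_i : {mpoly K[n]}) \isn't a GRing.unit.
Proof.
apply/negP => /mpoly_unitP[c _] /(congr1 (mcoeff U_(i)%MM)).
rewrite mcoeffXU eqxx mcoeffC mnm1_eq0 mulr0 => /eqP.
by rewrite oner_eq0.
Qed.

Lemma dvd_variable i F : (forall m, m \in msupp F -> (0 < m i)%N) ->
  exists G, F = 'X_i * G.
Proof.
move=> Fi; exists (\sum_(m <- msupp F) F@_m *: 'X_[m - U_(i)]).
rewrite mulr_sumr {1}[F]mpolyE; apply: eq_big_seq => m /Fi mi.
rewrite -scalerAr -mpolyXD addmC submK //.
by apply/mnm_lepP => j; rewrite mnm1E; case: eqP => [<-|].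
Qed.

(** Restriction to the coordinate hyperplane X_i = 0. *)
Definition kill_variable i : {mpoly K[n]} -> {mpoly K[n]} :=
  mmap (@mpolyC n K) (fun j => if j == i then 0 else 'X_j).

Lemma mcoeff_kill_variable i F m : (kill_variable i F)@_m = F@_m *+ (m i == 0%N).
Proof.
rewrite /kill_variable /mmap raddf_sum /=.
have E m' : mmap1 (fun j => if j == i then 0 else 'X_j) m' = 'X_[m'] *+ (m' i == 0%N) :> {mpoly K[n]}.
  rewrite /mmap1; case: eqP => [m'i|/eqP m'i].
    rewrite mpolyXE_id; apply: eq_bigr => j _; case: eqP => // ->.
    by rewrite m'i !expr0.
  by rewrite (bigD1 i) //= eqxx expr0n (negPf m'i) mul0r.
under eq_bigr do rewrite E mulrnAr mcoeffMn mul_mpolyC mcoeffZ mcoeffX.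
have [mF|mF] := boolP (m \in msupp F).
  rewrite (bigD1_seq m) ?msupp_uniq //= eqxx mulr1 big1 ?addr0 // => m' /negPf->.
  by rewrite mulr0 mul0rn.
rewrite (memN_msupp_eq0 mF) mul0rn big_seq big1 // => m' m'F.
by case: eqP => [mm|_]; rewrite ?mulr0 ?mul0rn //; rewrite -mm m'F in mF.
Qed.

(** The kernel of [kill_variable], a morphism to a domain, is generated by X_i. *)
Lemma variable_prime i F G H : 'X_i * F = G * H ->
  (exists G1, G = 'X_i * G1) \/ (exists H1, H = 'X_i * H1).
Proof.
have kill0 P : kill_variable i P = 0 -> exists P1, P = 'X_i * P1.
  move=> P0; apply: dvd_variable => m; rewrite mcoeff_msupp; apply: contraNT.
  by rewrite -eqn0Ngt => mi; have := mcoeff_kill_variable i P m; rewrite P0 mcoeff0 mi mulr1n => <-.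
move=> /(congr1 (kill_variable i)); rewrite /kill_variable !rmorphM /=.
rewrite {1}/mmap msuppX big_seq1 mcoeffX eqxx mmap1U eqxx mulr0 mul0r => /esym/eqP.
by rewrite mulf_eq0 => /orP[] /eqP/kill0; [left|right].
Qed.

End Variables.

Section Dehomogenization.
Variable C : closedFieldType.
Implicit Types F G H : {mpoly C[4]}.

Definition dehom_var (i : 'I_4) : {poly {poly C}} :=
  if i == i_t then 'X%:P else if i == i_v then 'X else 1.

(** Restriction to the chart s = u = 1, with Z = t (inner) and W = v (outer). *)
Definition dehom : {mpoly C[4]} -> {poly {poly C}} :=
  mmap (polyC \o polyC) dehom_var.

HB.instance Definition _ := GRing.RMorphism.on dehom.

Lemma ord4P (Q : 'I_4 -> Prop) : Q i_s -> Q i_t -> Q i_u -> Q i_v -> forall i, Q i.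
Proof.
move=> Qs Qt Qu Qv; case=> [[|[|[|[|//]]]] lt4].
- by rewrite (_ : Ordinal lt4 = i_s) //; apply: val_inj.
- by rewrite (_ : Ordinal lt4 = i_t) //; apply: val_inj.
- by rewrite (_ : Ordinal lt4 = i_u) //; apply: val_inj.
- by rewrite (_ : Ordinal lt4 = i_v) //; apply: val_inj.
Qed.

Lemma prod_ord4 (A : comNzRingType) (f : 'I_4 -> A) :
  \prod_i f i = f i_s * f i_t * f i_u * f i_v.
Proof.
rewrite !big_ord_recl big_ord0 mulr1 !mulrA.
by congr (f _ * f _ * f _ * f _); apply: val_inj.
Qed.

Lemma dehomE F : dehom F = \sum_(m <- msupp F) (F@_m *: 'X^(m i_t)) *: 'X^(m i_v).
Proof.
apply: eq_bigr => m _; rewrite /mmap1 prod_ord4 /dehom_var /=.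
by rewrite !expr1n mul1r mulr1 -rmorphXn mulrA -polyCM !mul_polyC.
Qed.

Lemma dehom_X i : dehom 'X_i = dehom_var i.
Proof. by rewrite /dehom mmapX mmap1U. Qed.

Lemma dehom0 : dehom 0 = 0. Proof. exact: rmorph0. Qed.
Lemma dehomB F G : dehom (F - G) = dehom F - dehom G. Proof. exact: rmorphB. Qed.
Lemma dehomM F G : dehom (F * G) = dehom F * dehom G. Proof. exact: rmorphM. Qed.
Lemma dehomC c : dehom c%:MP = c%:P%:P. Proof. exact: mmapC. Qed.
Lemma dehomXn F n : dehom (F ^+ n) = dehom F ^+ n. Proof. exact: rmorphXn. Qed.

Lemma constant_unit F : F \is a GRing.unit -> constant2 (dehom F).
Proof. by move=> /mpoly_unitP[c _ ->]; exists c; rewrite dehomC. Qed.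

(** For n1 and n2 large the truncated exponents are exact, and this is a section of
    n1 C0 + n2 f; it is a right inverse of [dehom] in any case. *)
Definition homogenization e n1 n2 (p : {poly {poly C}}) : {mpoly C[4]} :=
  \sum_(l < size p) \sum_(j < size p`_l)
    p`_l`_j *: (('X_i_s ^+ (n2 - j - e * (n1 - l)) * 'X_i_t ^+ j) * 'X_i_u ^+ (n1 - l) * 'X_i_v ^+ l).

Lemma homogenizationK e n1 n2 p : dehom (homogenization e n1 n2 p) = p.
Proof.
rewrite -[RHS]coefK poly_def rmorph_sum; apply: eq_bigr => l _.
have -> : p`_l *: 'X^l = (\sum_(j < size p`_l) p`_l`_j *: 'X^j) *: 'X^l.
  by rewrite -poly_def coefK.
rewrite scaler_suml rmorph_sum; apply: eq_bigr => j _.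
rewrite /= -mul_mpolyC !rmorphM !rmorphXn /= [dehom _%:MP]mmapC !dehom_X /dehom_var /=.
by rewrite !expr1n mul1r mulr1 -rmorphXn mulrA -polyCM !mul_polyC.
Qed.

(** The variables s and u become 1 in the chart, so cancelling them does not
    change the dehomogenizations. *)
Lemma strip_variable (i : 'I_4) n F G H : dehom ('X_i : {mpoly C[4]}) = 1 ->
    'X_i ^+ n * F = G * H ->
  exists G' H', [/\ F = G' * H', dehom G' = dehom G & dehom H' = dehom H].
Proof.
move=> Xi1; elim: n G H => [|n IHn] G H; first by rewrite mul1r; exists G, H.
have Xi0 : 'X_i != 0 :> {mpoly C[4]}.
  by apply/eqP => X0; move/eqP: Xi1; rewrite X0 dehom0 eq_sym oner_eq0.
rewrite exprS -mulrA => E; have [[G1 GE]|[H1 HE]] := variable_prime E.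
  have /IHn[G' [H' [FE G'G1 H'H]]] : 'X_i ^+ n * F = G1 * H.
    by apply: (mulfI Xi0); rewrite [RHS]mulrA -GE.
  by exists G', H'; split=> //; rewrite ?GE ?HE [RHS]dehomM Xi1 mul1r.
have /IHn[G' [H' [FE G'G H'H1]]] : 'X_i ^+ n * F = G * H1.
  by apply: (mulfI Xi0); rewrite [RHS]mulrCA -HE.
by exists G', H'; split=> //; rewrite ?GE ?HE [RHS]dehomM Xi1 mul1r.
Qed.

End Dehomogenization.

Section Sections.
Variables (R : realType) (e : nat).
Local Notation C := (R[i]).
Implicit Types (F G : {mpoly C[4]}) (al be d : nat).

Lemma eq_mnm4 (m m' : 'X_{1..4}) :
  m i_s = m' i_s -> m i_t = m' i_t -> m i_u = m' i_u -> m i_v = m' i_v -> m = m'.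
Proof. by move=> ms mt mu mv; apply/mnmP; apply: ord4P. Qed.

Lemma monomial_classP al be (m : 'X_{1..4}) :
  monomial_class e m = (al%:Z, be%:Z) <->
  (m i_u + m i_v)%N = al /\ (m i_s + m i_t + e * m i_u)%N = be.
Proof. by split=> [[-> ->]|[<- <-]]. Qed.

Lemma is_sectionM D1 D2 F G :
  is_section e D1 F -> is_section e D2 G -> is_section e (D1 + D2) (F * G).
Proof.
move=> sF sG m /msuppM_le/allpairsP[[m1 m2] /= [/sF <- /sG <- ->]].
by rewrite /monomial_class !mnmDE; congr (_, _); rewrite /= -PoszD; congr Posz; lia.
Qed.

Lemma is_sectionX (m : 'X_{1..4}) : is_section e (monomial_class e m) ('X_[m] : {mpoly C[4]}).
Proof. by move=> m'; rewrite msuppX inE => /eqP->. Qed.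

Lemma is_section_sum (I : eqType) (s : seq I) (f : I -> {mpoly C[4]}) D :
  (forall i, i \in s -> is_section e D (f i)) -> is_section e D (\sum_(i <- s) f i).
Proof.
move=> sf; rewrite big_seq; apply: (big_ind (is_section e D)) => [m|F G sF sG m|i /sf//].
  by rewrite msupp0.
by move/msuppD_le; rewrite mem_cat => /orP[/sF|/sG].
Qed.

Lemma section_nonzero D F : is_section e D F -> F != 0 ->
  exists al be : nat, D = (al%:Z, be%:Z).
Proof.
move=> sF; rewrite -msupp_eq0; case E : (msupp F) => [//|m s] _.
by rewrite -(sF m) ?E ?mem_head //; do 2!eexists.
Qed.

(** Within a fixed class, a monomial is determined by its exponents in t and v. *)
Lemma coef_dehom al be F m0 : is_section e (al%:Z, be%:Z) F ->
  monomial_class e m0 = (al%:Z, be%:Z) -> (dehom F)`_(m0 i_v)`_(m0 i_t) = F@_m0.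
Proof.
move=> sF /monomial_classP[c1 c2]; rewrite dehomE !coef_sum.
have E m : m \in msupp F ->
    ((F@_m *: 'X^(m i_t)) *: 'X^(m i_v) : {poly {poly C}})`_(m0 i_v)`_(m0 i_t) = F@_m *+ (m == m0).
  move=> /sF/monomial_classP[d1 d2]; rewrite coefZ coefXn.
  case: eqP => [ev|nv]; last first.
    by rewrite mulr0 coef0; case: eqP => [mm|]; rewrite ?mulr0n // mm in nv.
  rewrite mulr1 coefZ coefXn; case: eqP => [et|nt]; last first.
    by rewrite mulr0; case: eqP => [mm|]; rewrite ?mulr0n // mm in nt.
  by rewrite mulr1 (_ : m = m0) ?eqxx //; apply: eq_mnm4 => //; nia.
rewrite (eq_big_seq _ E); have [mF|mF] := boolP (m0 \in msupp F).
  by rewrite (bigD1_seq m0) ?msupp_uniq //= eqxx big1 ?addr0 // => m /negPf->.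
rewrite (memN_msupp_eq0 mF) big_seq big1 // => m mF'.
by case: eqP => // mm; rewrite -mm mF' in mF.
Qed.

Lemma dehom_inj D F G : is_section e D F -> is_section e D G -> dehom F = dehom G -> F = G.
Proof.
move=> sF sG FG; have [F0|] := eqVneq (F - G) 0; first exact/subr0_eq.
have sFG : is_section e D (F - G).
  by move=> m /msuppB_le; rewrite mem_cat => /orP[/sF|/sG].
move=> nz; have [al [be DE]] := section_nonzero sFG nz; subst D.
case/negP: nz; apply/eqP/mpolyP => m; rewrite mcoeff0.
have [mFG|/memN_msupp_eq0//] := boolP (m \in msupp (F - G)).
have FG0 : dehom (F - G) = 0 by rewrite dehomB; apply/eqP; rewrite subr_eq0; apply/eqP.
by rewrite -(coef_dehom sFG (sFG _ mFG)) FG0 !coef0.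
Qed.

Lemma section_trapezoid al d F :
  is_section e (al%:Z, (e * al + d)%:Z) F -> trapezoid e al d (dehom F).
Proof.
move=> sF; rewrite dehomE; split=> [|l].
  apply/leq_sizeP => l le_l; rewrite coef_sum big_seq big1 // => m /sF/monomial_classP[c1 c2].
  by rewrite coefZ coefXn gtn_eqF ?mulr0 //; lia.
apply/leq_sizeP => j le_j; rewrite !coef_sum big_seq big1 // => m /sF/monomial_classP[c1 c2].
rewrite coefZ coefXn; case: eqP => [lE|_]; last by rewrite mulr0 coef0.
by rewrite mulr1 coefZ coefXn gtn_eqF ?mulr0 //; subst l; nia.
Qed.

Lemma homogenization_section n1 n2 k (p : {poly {poly C}}) :
    (size p <= n1.+1)%N -> (forall l, size (p`_l)%R <= k.+1)%N -> (e * n1 + k <= n2)%N ->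
  is_section e (n1%:Z, n2%:Z) (homogenization e n1 n2 p).
Proof.
move=> szp szk le_n2; apply: is_section_sum => l _; apply: is_section_sum => j _.
pose m := [multinom nth 0%N [:: n2 - j - e * (n1 - l); nat_of_ord j; n1 - l; nat_of_ord l]%N i | i < 4].
rewrite (_ : _ * _ = 'X_[m]); last first.
  by rewrite [RHS]mpolyXE_id prod_ord4 /m !mnmE.
move=> m' /msuppZ_le; rewrite msuppX inE => /eqP->; apply/monomial_classP; rewrite !mnmE /=.
have := leq_trans (ltn_ord l) szp; have := leq_trans (ltn_ord j) (szk l).
move: (nat_of_ord l) (nat_of_ord j) => x y lt_y lt_x.
have : (e * (n1 - x) <= e * n1)%N by rewrite leq_mul2l leq_subr orbT.
move: (e * (n1 - x))%N (e * n1)%N le_n2 => A B le_n2 le_AB; lia.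
Qed.

(** A factorization g h of the affine equation homogenizes to a factorization of
    s^x u^y F, from which s and u can be stripped. The point (z, w) excludes that
    F is s or u, whose affine equation is constant. *)
Lemma irreducible_dehom al be F z w : is_section e (al%:Z, be%:Z) F ->
  irreducible_mpoly F -> vanishes 1 z w (dehom F) -> irreducible2 (dehom F).
Proof.
move=> sF [F0 Fnu Firr] vF; split=> [[c cE]|g h FE].
  have := vF 0%N 0%N isT; rewrite cE /shift map_polyC /= !comp_polyC !coefC /= => c0.
  case/eqP: F0; apply: (dehom_inj sF (G := 0)) => [m|]; first by rewrite msupp0.
  by rewrite cE c0 dehom0 !polyC0.
pose k := (\max_(l < size g) size (g`_l)%R + \max_(l < size h) size (h`_l)%R)%N.
have leg l : (size (g`_l)%R <= k.+1)%N.
  have [lt_l|le_l] := ltnP l (size g); last by rewrite nth_default ?size_poly0.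
  by apply/leqW/(leq_trans _ (leq_addr _ _)); apply: (leq_bigmax (Ordinal lt_l)).
have leh l : (size (h`_l)%R <= k.+1)%N.
  have [lt_l|le_l] := ltnP l (size h); last by rewrite nth_default ?size_poly0.
  by apply/leqW/(leq_trans _ (leq_addl _ _)); apply: (leq_bigmax (Ordinal lt_l)).
(* Large enough for the homogenizations of g and h, and for x, y >= 0. *)
pose n1 := (size g + size h + al)%N; pose n2 := (e * n1 + k + be)%N.
have sg : is_section e (n1%:Z, n2%:Z) (homogenization e n1 n2 g).
  apply: (homogenization_section (k := k)) => //; last exact: leq_addr.
  by rewrite /n1 -addnA -addnS leq_addr.
have sh : is_section e (n1%:Z, n2%:Z) (homogenization e n1 n2 h).
  apply: (homogenization_section (k := k)) => //; last exact: leq_addr.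
  exact/leqW/(leq_trans (leq_addl (size g) _) (leq_addr _ _)).
pose y := (n1 + n1 - al)%N; pose x := (n2 + n2 - be - e * y)%N.
have sxy : is_section e ((n1%:Z, n2%:Z) + (n1%:Z, n2%:Z))
    ('X_[U_(i_s) *+ x] * ('X_[U_(i_u) *+ y] * F)).
  rewrite (_ : _ + _ = monomial_class e (U_(i_s) *+ x)%MM +
      (monomial_class e (U_(i_u) *+ y)%MM + (al%:Z, be%:Z))).
    by do 2![apply: is_sectionM; first exact: is_sectionX].
  have le_y : (e * y <= n2 + n2 - be)%N by rewrite /y /n2 /n1; nia.
  have le_al : (al <= n1 + n1)%N by exact: (leq_trans (leq_addl (size g + size h) al) (leq_addl n1 n1)).
  have le_be : (be <= n2 + n2)%N by exact: (leq_trans (leq_addl (e * n1 + k) be) (leq_addl n2 n2)).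
  rewrite /monomial_class !mulmnE !mnm1E /=.
  congr (_, _); rewrite /= !mul0n !mul1n ?muln0 ?addn0 ?add0n -!PoszD; congr Posz.
    by rewrite subnK.
  by rewrite addnA subnK // subnK.
have E : 'X_[U_(i_s) *+ x] * ('X_[U_(i_u) *+ y] * F) =
    homogenization e n1 n2 g * homogenization e n1 n2 h.
  apply: (dehom_inj sxy); first exact: is_sectionM.
  rewrite !dehomM !homogenizationK -FE -!mpolyXn !dehomXn !dehom_X /dehom_var /=.
  by rewrite !expr1n !mul1r.
rewrite -!mpolyXn in E.
have [|G [H [E1 Gg Hh]]] := strip_variable _ E; first by rewrite dehom_X.
have [|G' [H' [E2 G'g H'h]]] := strip_variable _ E1; first by rewrite dehom_X.
have [/constant_unit|/constant_unit] := Firr _ _ E2.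
  by rewrite G'g Gg homogenizationK; left.
by rewrite H'h Hh homogenizationK; right.
Qed.

End Sections.

(** * Multiplicities in the affine chart *)

Section LocalRing.
Variable C : closedFieldType.

Definition i_0 : 'I_2 := @Ordinal 2 0 isT.
Definition i_1 : 'I_2 := @Ordinal 2 1 isT.

(** The coordinates X_0, X_1 of a chart, renamed Z and W. *)
Definition local_dehom : {mpoly C[2]} -> {poly {poly C}} :=
  mmap (polyC \o polyC) (fun i => if i == i_0 then 'X%:P else 'X).

HB.instance Definition _ := GRing.RMorphism.on local_dehom.

Lemma local_dehomD p q : local_dehom (p + q) = local_dehom p + local_dehom q.
Proof. exact: mmapD. Qed.
Lemma local_dehomM p q : local_dehom (p * q) = local_dehom p * local_dehom q.
Proof. exact: rmorphM. Qed.
Lemma local_dehomXn p n : local_dehom (p ^+ n) = local_dehom p ^+ n.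
Proof. exact: rmorphXn. Qed.
Lemma local_dehomC c : local_dehom c%:MP = c%:P%:P.
Proof. exact: mmapC. Qed.
Lemma local_dehom0 : local_dehom 0 = 0.
Proof. exact: rmorph0. Qed.

Lemma coef_local_dehom (q : {mpoly C[2]}) (m : 'X_{1..2}) :
  (local_dehom q)`_(m i_1)`_(m i_0) = q@_m.
Proof.
have E : local_dehom q = \sum_(m <- msupp q) (q@_m *: 'X^(m i_0)) *: 'X^(m i_1).
  apply: eq_bigr => m' _; rewrite /mmap1 !big_ord_recl big_ord0 mulr1 /=.
  rewrite (_ : ord0 = i_0); last exact: val_inj.
  rewrite (_ : lift i_0 ord0 = i_1); last exact: val_inj.
  by rewrite -rmorphXn mulrA -polyCM !mul_polyC.
rewrite E !coef_sum [RHS](_ : _ = \sum_(m' <- msupp q) q@_m' *+ (m' == m)).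
  apply: eq_bigr => m' _; rewrite coefZ coefXn; have [e1|n1] := eqVneq (m i_1) (m' i_1).
    rewrite mulr1 coefZ coefXn; have [e0|n0] := eqVneq (m i_0) (m' i_0).
      rewrite mulr1 (_ : m' = m) ?eqxx //; apply/mnmP; case=> [[|[|//]]] lt2.
        by rewrite (_ : Ordinal lt2 = i_0) //; apply: val_inj.
      by rewrite (_ : Ordinal lt2 = i_1) //; apply: val_inj.
    by rewrite mulr0; case: eqP => [mm|]; rewrite ?mulr0n // mm eqxx in n0.
  by rewrite mulr0 coef0; case: eqP => [mm|]; rewrite ?mulr0n // mm eqxx in n1.
have [mq|mq] := boolP (m \in msupp q).
  by rewrite (bigD1_seq m) ?msupp_uniq //= eqxx big1 ?addr0 // => m' /negPf->.
rewrite (memN_msupp_eq0 mq) big_seq big1 // => m' mq'.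
by case: eqP => // mm; rewrite -mm mq' in mq.
Qed.

Lemma local_dehom_comp (F : {mpoly C[4]}) (t : 4.-tuple {mpoly C[2]}) z w :
    (forall i, local_dehom (tnth t i) = shift z w (dehom_var C i)) ->
  local_dehom (F \mPo t) = shift z w (dehom F).
Proof.
move=> tE; elim/mpolyind: F => [|c m F _ _ IHF].
  by rewrite comp_mpoly0 dehom0 local_dehom0 /shift map_poly0 comp_poly0.
have shiftD f g : shift z w (f + g) = shift z w f + shift z w g.
  by rewrite /shift rmorphD comp_polyD.
have shiftM f g : shift z w (f * g) = shift z w f * shift z w g.
  by rewrite /shift rmorphM comp_polyM.
rewrite comp_mpolyD local_dehomD IHF /dehom mmapD shiftD; congr (_ + _).
rewrite comp_mpolyZ -mul_mpolyC local_dehomM local_dehomC mmapZ shiftM.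
rewrite /= {1}/shift map_polyC /= !comp_polyC; congr (_ * _).
rewrite comp_mpolyX mmapX /mmap1.
have shiftX f n : shift z w (f ^+ n) = shift z w f ^+ n.
  elim: n => [|n IHn]; first by rewrite !expr0 /shift rmorph1 comp_polyC.
  by rewrite !exprS shiftM IHn.
by rewrite !prod_ord4 !shiftM !shiftX !local_dehomM !local_dehomXn !tE.
Qed.

End LocalRing.

Lemma bigmin_le (T : eqType) (s : seq T) (f : T -> nat) x0 t :
  t \in s -> (\big[minn/x0]_(u <- s) f u <= f t)%N.
Proof.
elim: s => // u s IHs; rewrite inE big_cons => /predU1P[->|/IHs le_t]; first exact: geq_minl.
exact: leq_trans (geq_minr _ _) le_t.
Qed.

Lemma bigmin_attained (T : eqType) (s : seq T) (f : T -> nat) x0 :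
  \big[minn/x0]_(u <- s) f u = x0 \/ exists2 t, t \in s & \big[minn/x0]_(u <- s) f u = f t.
Proof.
elim: s => [|u s IHs]; first by rewrite big_nil; left.
rewrite big_cons; case: leqP => _; first by right; exists u; rewrite ?mem_head.
by case: IHs => [->|[t ts ->]]; [left | right; exists t; rewrite // inE ts orbT].
Qed.

Section Multiplicity.
Variables (R : realType) (z w : R[i]).
Implicit Types F : {mpoly R[i][4]}.

(** The point (s, t, u, v) = (1, z, 1, w). *)
Definition affine_coord (i : 'I_4) : R[i] :=
  if i == i_t then z else if i == i_v then w else 1.

Fact affine_base : (affine_coord i_s != 0) || (affine_coord i_t != 0).
Proof. by rewrite /affine_coord /= oner_eq0. Qed.
Fact affine_fibre : (affine_coord i_u != 0) || (affine_coord i_v != 0).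
Proof. by rewrite /affine_coord /= oner_eq0. Qed.

Definition affine_point : Defs.point R := Point affine_base affine_fibre.

(** The local equation in the chart centred at (1, z, 1, w) is the affine equation
    translated to (z, w). *)
Lemma coef_local_eq F (m : 'X_{1..2}) :
  (local_eq affine_point F)@_m = (shift z w (dehom F))`_(m i_1)`_(m i_0).
Proof.
rewrite -coef_local_dehom /local_eq (local_dehom_comp _ (z := z) (w := w)) //.
have L0 : local_dehom ('X_i_0 : {mpoly R[i][2]}) = 'X%:P by rewrite /local_dehom mmapX mmap1U.
have L1 : local_dehom ('X_i_1 : {mpoly R[i][2]}) = 'X by rewrite /local_dehom mmapX mmap1U.
have S1 : shift z w 1 = 1 by rewrite /shift rmorph1 comp_polyC.
have St : shift z w 'X%:P = 'X%:P + z%:P%:P.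
  by rewrite /shift map_polyC /= comp_polyX comp_polyC polyCD.
have Sv : shift z w 'X = 'X + w%:P%:P.
  by rewrite /shift map_polyX /= comp_polyX.
apply: ord4P; rewrite (tnth_nth 0) /= /affine_coord /dehom_var /= oner_eq0 local_dehomD local_dehomC ?local_dehom0 ?L0 ?L1.
- by rewrite addr0 S1.
- by rewrite St addrC.
- by rewrite addr0 S1.
- by rewrite Sv addrC.
Qed.

Lemma local_eq_nz F : dehom F != 0 -> local_eq affine_point F != 0.
Proof.
move=> F0; apply: contraNneq F0 => L0; rewrite -size_poly_eq0 -(size_shift z w) size_poly_eq0.
apply/eqP/polyP => b; rewrite coef0; apply/polyP => a; rewrite coef0.
have := coef_local_eq F [multinom nth 0%N [:: a; b] i | i < 2].
by rewrite !mnmE /= L0 mcoeff0.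
Qed.

Lemma mdeg2 (m : 'X_{1..2}) : mdeg m = (m i_0 + m i_1)%N.
Proof.
rewrite mdegE !big_ord_recl big_ord0 addn0; congr (m _ + m _)%N; exact: val_inj.
Qed.

Lemma mult_vanishes F : vanishes (mult affine_point F) z w (dehom F).
Proof.
move=> a b ab; pose m := [multinom nth 0%N [:: a; b] i | i < 2].
have := coef_local_eq F m; rewrite !mnmE /= => <-.
apply: memN_msupp_eq0; apply: contraTN ab => mq; rewrite -leqNgt.
by have := bigmin_le mdeg (msize (local_eq affine_point F)) mq; rewrite mdeg2 !mnmE.
Qed.

Lemma mult_sharp F : dehom F != 0 -> ~ vanishes (mult affine_point F).+1 z w (dehom F).
Proof.
move/local_eq_nz => L0 van.
have : ~~ nilp (msupp (local_eq affine_point F)) by rewrite /nilp size_eq0 msupp_eq0.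
case E : (msupp _) => [//|m0 s] _.
have m0q : m0 \in msupp (local_eq affine_point F) by rewrite E mem_head.
have : exists2 m, m \in msupp (local_eq affine_point F) & mult affine_point F = mdeg m.
  have [multE|//] := bigmin_attained (msupp (local_eq affine_point F)) mdeg (msize (local_eq affine_point F)).
  have := bigmin_le mdeg (msize (local_eq affine_point F)) m0q; rewrite multE.
  by rewrite leqNgt msize_mdeg_lt.
case=> m; rewrite mcoeff_msupp => /eqP mq multE; apply: mq; rewrite coef_local_eq.
by apply: van; rewrite multE mdeg2.
Qed.

Lemma eval_affine_point F : F.@[affine_point] = 0 <-> vanishes 1 z w (dehom F).
Proof.
have E : F.@[affine_point] = (shift z w (dehom F))`_0`_0.
  have <- : (local_eq affine_point F)@_0 = (shift z w (dehom F))`_0`_0.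
    by rewrite coef_local_eq !mnm0E.
  have ev0 (q : {mpoly R[i][2]}) : q.@[fun=> 0] = q@_0.
    rewrite mevalE [RHS](_ : _ = \sum_(m <- msupp q) q@_m *+ (m == 0%MM)).
      apply: eq_bigr => m _; rewrite [\prod_i _](_ : _ = (m == 0%MM)%:R) ?mulr_natr //.
      rewrite !big_ord_recl big_ord0 mulr1 !expr0n -natrM mulnb -addn_eq0.
      congr (nat_of_bool _)%:R; rewrite -mdeg_eq0 mdeg2.
      by congr (m _ + m _ == 0)%N; apply: val_inj.
    have [mq|mq] := boolP (0%MM \in msupp q).
      by rewrite (bigD1_seq 0%MM) ?msupp_uniq //= eqxx big1 ?addr0 // => m' /negPf->.
    rewrite (memN_msupp_eq0 mq) big_seq big1 // => m' mq'.
    by case: eqP => // mm; rewrite -mm mq' in mq.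
  rewrite -ev0 comp_mpoly_meval; apply: meval_eq.
  apply: ord4P; rewrite (tnth_nth 0) /= /affine_coord /= oner_eq0 mevalD mevalC ?mevalXU ?meval0 addr0 //.
rewrite E; split=> [v0 a b|]; last by apply.
by rewrite ltnS leqn0 addn_eq0 => /andP[/eqP-> /eqP->].
Qed.

Lemma mult_gt0 F : dehom F != 0 -> F.@[affine_point] = 0 -> (0 < mult affine_point F)%N.
Proof.
move=> F0 /eval_affine_point v1; rewrite lt0n; apply/negP => /eqP m0.
by apply: (mult_sharp F0); rewrite m0.
Qed.

End Multiplicity.

(** * Curves and ample classes *)

Section Fibre.
Variable C : closedFieldType.

(** Such a curve is a single reduced fibre Z = a. *)
Lemma vertical_multiplicity (f : {poly {poly C}}) : irreducible2 f -> (size f <= 1)%N ->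
  exists a : C, forall z w k, vanishes k z w f -> (k <= (z == a))%N.
Proof.
move=> irrf /size1_polyC; set c := f`_0 => fE.
have szc : size c != 1%N.
  apply/eqP => sz1; case: irrf => [[]]; exists c`_0.
  by rewrite fE -size1_polyC ?sz1.
have /closed_rootP[a /factor_theorem[c1 cE]] := szc.
have [|k k0 fE1] := irreducible2_not_fibre (a := a) (f1 := c1%:P) irrf.
  by rewrite fE cE polyCM mul_polyC -mul_polyC mulrC mul_polyC.
exists a => z w m van.
have shE : shift z w f = (k *: ('X + (z - a)%:P))%:P.
  rewrite fE1 /shift map_polyC /= comp_polyC comp_polyZ comp_polyD comp_polyX.
  by rewrite -polyCN comp_polyC -addrA -polyCD.
case: eqP => [_|za] /=; rewrite leqNgt; apply/negP => mgt.
  have := van 1%N 0%N mgt; rewrite shE coefC /= coefZ coefD coefX coefC /= addr0 mulr1.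
  by apply/eqP.
have := van 0%N 0%N mgt; rewrite shE coefC /= coefZ coefD coefX coefC /= add0r.
by move/eqP; rewrite mulf_eq0 (negPf k0) subr_eq0 => /eqP.
Qed.

End Fibre.

Section Curves.
Variables (R : realType) (e : nat).
Implicit Types F G : {mpoly R[i][4]}.

(** Otherwise X_i divides F, hence equals it up to a constant, and F does not
    vanish at p. *)
Lemma variable_missing F (p : Defs.point R) i : irreducible_mpoly F -> F.@[p] = 0 -> p i != 0 ->
  exists2 m, m \in msupp F & m i = 0%N.
Proof.
move=> [F0 Fnu Firr] Fp pi0; apply: boolp.contrapT => nm.
have [m mF|G GE] := @dvd_variable _ _ i F.
  by rewrite lt0n; apply/eqP => mi; apply: nm; exists m.
have [Xu|/mpoly_unitP[c c0 GC]] := Firr _ _ GE; first by have := mpolyX_nunit R[i] i; rewrite Xu.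
move/eqP: Fp; rewrite GE GC mevalM mevalXU mevalC mulf_eq0 (negPf c0) orbF.
by rewrite (negPf pi0).
Qed.

(** A monomial of F without u reaches the top side of the trapezoid, and one
    without s its slanted side. So a polynomial of positive degree times f leaves
    the trapezoid, through the top or through that side. *)
Lemma tight_trapezoid al d F : is_section e (al%:Z, (e * al + d)%:Z) F ->
    (exists2 m, m \in msupp F & m i_s = 0%N) -> (exists2 m, m \in msupp F & m i_u = 0%N) ->
  forall g q, trapezoid e al d g -> g = q * dehom F -> exists c : R[i], g = c%:P%:P * dehom F.
Proof.
move=> sF [ms msF ms0] [mu muF mu0] g q [szg wg] gE.
have [szf wf] := section_trapezoid sF.
have coef_nz m : m \in msupp F -> (dehom F)`_(m i_v)`_(m i_t) != 0.
  by move=> mF; rewrite (coef_dehom sF (sF _ mF)) -mcoeff_msupp.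
have /monomial_classP[u1 u2] := sF _ muF.
have /monomial_classP[s1 s2] := sF _ msF.
have szF : size (dehom F) = al.+1.
  apply/eqP; rewrite eqn_leq szf ltnNge; apply: contraNN (coef_nz _ muF) => le_sz.
  by rewrite [(dehom F)`_ _]nth_default ?coef0 //; apply: leq_trans le_sz _; rewrite -u1 mu0.
have szs : size (dehom F)`_(ms i_v) = (d + e * ms i_v).+1.
  apply/eqP; rewrite eqn_leq wf ltnNge; apply: contraNN (coef_nz _ msF) => le_sz.
  by rewrite nth_default //; apply: leq_trans le_sz _; rewrite -s1 mulnDr in s2; lia.
have [q0|q0] := eqVneq q 0; first by exists 0; rewrite gE q0 !polyC0 !mul0r.
have F0 : dehom F != 0 by rewrite -size_poly_gt0 szF.
have szq : (size q <= 1)%N.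
  move: szg; rewrite gE size_mul // szF addnS /=; move: (size q) => s.
  by rewrite -[X in (_ <= X)%N -> _]add1n leq_add2r.
have qE := size1_polyC szq; set c := q`_0 in qE.
have c0 : c != 0 by apply: contraNneq q0 => c0; rewrite qE c0.
exists c`_0; rewrite gE qE; congr (_%:P * _); apply: size1_polyC.
have := wg (ms i_v); rewrite gE qE coefCM size_mul //; last by rewrite -size_poly_gt0 szs.
rewrite szs addnS /=; move: (size c) (d + _)%N => s t.
by rewrite -[X in (_ <= X)%N -> _]add1n leq_add2r.
Qed.

Lemma dehom_supp F l j : (dehom F)`_l`_j != 0 ->
  exists2 m, m \in msupp F & m i_t = j /\ m i_v = l.
Proof.
move=> nz; apply: boolp.contrapT => nm; move: nz; rewrite dehomE !coef_sum big_seq big1 ?eqxx //.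
move=> m mF; rewrite coefZ coefXn; case: eqP => [lE|_]; last by rewrite mulr0 coef0.
rewrite mulr1 coefZ coefXn; case: eqP => [jE|_]; last by rewrite mulr0.
by case: nm; exists m.
Qed.

(** Separation of tangent vectors at (1, 0, 1, 0), a point of C0: a section whose
    differential there is (1, 1) contains monomials in which t and v occur to the
    orders (1, 0) and (0, 1). *)
Lemma very_ample_bounds (D : line_bundle) : very_ample R e D ->
  exists al c : nat, D = (al.+1%:Z, (e * al.+1 + c.+1)%:Z).
Proof.
case=> _ /(_ (affine_point 0 0) 1 1)[F [sF _]].
have sh0 f : shift 0 0 f = f :> {poly {poly R[i]}}.
  rewrite /shift !polyC0 !addr0 comp_polyXr; apply/polyP => i.
  by rewrite coef_map_id0 ?comp_poly0 ?comp_polyXr.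
rewrite !coef_local_eq !mnm1E /= !sh0 => F1 F2.
have [m1 m1F [m1t m1v]] : exists2 m, m \in msupp F & m i_t = 1%N /\ m i_v = 0%N.
  by apply: dehom_supp; rewrite F1 oner_eq0.
have [m2 m2F [m2t m2v]] : exists2 m, m \in msupp F & m i_t = 0%N /\ m i_v = 1%N.
  by apply: dehom_supp; rewrite F2 oner_eq0.
have F0 : F != 0 by rewrite -msupp_eq0; case: (msupp F) m1F.
have [al [be DE]] := section_nonzero sF F0; subst D.
have /monomial_classP[c1 c2] := sF _ m1F; have /monomial_classP[d1 d2] := sF _ m2F.
exists al.-1, (be - e * al).-1; congr (Posz _, Posz _); first by lia.
have al0 : al.-1.+1 = al by lia.
rewrite al0 prednK; first by rewrite subnKC //; move: c2; rewrite -c1 m1v m1t addn0; lia.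
by move: c2; rewrite -c1 m1v m1t addn0; lia.
Qed.

(** The case of [very_ample_bounds] for a multiple of L, divided by the factor. *)
Lemma ample_bounds (L : line_bundle) : ample R e L ->
  exists a c : nat, [/\ (0 < a)%N, (0 < c)%N & L = (a%:Z, (e * a + c)%:Z)].
Proof.
case=> -[//|n] _ /very_ample_bounds[al [c]]; case: L => x y LE.
have [xE yE] : x *+ n.+1 = al.+1%:Z /\ y *+ n.+1 = (e * al.+1 + c.+1)%:Z.
  by move: LE; rewrite pairMnE => -[-> ->].
rewrite -mulr_natr natz in xE; rewrite -mulr_natr natz in yE.
have x0 : 0 < x by rewrite -(pmulr_lgt0 x (x := n.+1%:Z)) ?xE.
have yx : e%:Z * x < y.
  by rewrite -(ltr_pM2r (x := n.+1%:Z)) // -mulrA xE yE -PoszM ltz_nat addnS ltnS leq_addr.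
have [xn xnE] : exists xn : nat, x = xn%:Z by exists (absz x); rewrite gez0_abs ?ltW.
pose u : int := y - e%:Z * x.
have u0 : 0 < u by rewrite subr_gt0.
have [c' uE] : exists c' : nat, u = c'%:Z by exists (absz u); rewrite gez0_abs ?ltW.
exists xn, c'; split; [by rewrite -ltz_nat -xnE | by rewrite -ltz_nat -uE |].
by congr (_, _); rewrite // PoszD PoszM -uE -xnE addrC subrK.
Qed.

End Curves.

(** * Very general points and the Seshadri constant *)

(** What the proof uses of the generality of the points; y lists the z_i and then
    the w_i. The w_i are nonzero so that no point lies on C0. *)
Definition very_general (R : realType) (e r : nat) (y : 'I_(r + r) -> R[i]) :=
  [/\ injective (fun i => y (lshift r i)), forall i, y (rshift r i) != 0 &
      forall al d (m : 'I_r -> nat) (f : {poly {poly R[i]}}), f != 0 ->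
        trapezoid e al d f ->
        (forall i, vanishes (m i) (y (lshift r i)) (y (rshift r i)) f) ->
      exists2 v : lattice_points e al d -> {mpoly R[i][r + r]},
        forall i a b, (a + b < m i)%N -> taylor v i a b = 0 &
        spread (fun p => (v p).@[y]) != 0].

(** There are countably many classes and multiplicities, and each of them excludes
    a hypersurface. *)
Lemma very_general_exists (R : realType) (e r : nat) :
  exists y, @very_general R e r y.
Proof.
pose T := (nat * nat * {ffun 'I_r -> nat})%type.
pose avoids (t : T) (g : {mpoly R[i][r + r]}) := g != 0 /\
    forall y, g.@[y] != 0 -> forall f, f != 0 -> trapezoid e t.1.1 t.1.2 f ->
    (forall i, vanishes (t.2 i) (y (lshift r i)) (y (rshift r i)) f) ->
    exists2 v : lattice_points e t.1.1 t.1.2 -> {mpoly R[i][r + r]},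
      forall i a b, (a + b < t.2 i)%N -> taylor v i a b = 0 &
      spread (fun p => (v p).@[y]) != 0.
have /boolp.choice[g gP] : forall t, exists g, avoids t g.
  move=> t.
  by have [g g0 gP] := @generic_section R[i] r e t.1.1 t.1.2 t.2; exists g.
pose P0 : {mpoly R[i][r + r]} :=
  (\prod_i \prod_(j | j != i) ('X_(lshift r i) - 'X_(lshift r j))) *
  \prod_i 'X_(rshift r i).
have P00 : P0 != 0.
  rewrite mulf_neq0 //; apply/prodf_neq0 => i _; last first.
    by rewrite -msupp_eq0 msuppX.
  apply/prodf_neq0 => j nij; rewrite subr_eq0; apply: contraNneq nij.
  by move=> /(congr1 (mcoeff U_(lshift r i)%MM))/eqP; rewrite !mcoeffXU eqxx eq_lshift; case: (j == i); rewrite // oner_eq0.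
(* The factor P0 makes the z_i distinct and the w_i nonzero. *)
pose h k := (if unpickle k is Some t then g t else 1) * P0.
have [y yP] : exists y : 'I_(r + r) -> R[i], forall k, (h k).@[y] != 0.
  apply: mpoly_avoid => k; rewrite mulf_neq0 //.
  by case: (unpickle k) => [t|]; [case: (gP t) | rewrite oner_eq0].
have yP0 : P0.@[y] != 0.
  by have := yP 0%N; rewrite mevalM mulf_eq0 negb_or => /andP[].
exists y; split=> [i j yij|i|al d m f f0 tf vf].
- apply/eqP; move: yP0; apply: contraNT; rewrite eq_sym => nij.
  rewrite mevalM rmorph_prod (bigD1 i) //= rmorph_prod (bigD1 j) //=.
  by rewrite mevalB !mevalXU yij subrr !mul0r.
- move: yP0; apply: contraNN => /eqP yi0.
  by rewrite mevalM [X in _ * X.@[_]](bigD1 i) //= mevalM mevalXU yi0 mul0r mulr0.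
- have := yP (pickle ((al, d, [ffun i => m i]) : T)).
  rewrite /h pickleK mevalM mulf_eq0 negb_or => /andP[gy _].
  have [_ /(_ y gy f f0 tf)] := gP (al, d, [ffun i => m i]).
  case=> [i|v vP v0]; first by rewrite ffunE; apply: vf.
  by exists v => // i a b ab; apply: vP; rewrite /= ffunE.
Qed.

Section Curve.
Variables (R : realType) (e r : nat) (y : 'I_(r + r) -> R[i]).
Hypothesis gen_y : very_general e y.
Let x i := affine_point (y (lshift r i)) (y (rshift r i)).
Variables (a c : nat).
Hypotheses (a0 : (0 < a)%N) (c0 : (0 < c)%N).
(* L . L and L . D for L = a C0 + (e a + c) f and D = al C0 + (e al + d) f. *)
Let LL := (a * (e * a + 2 * c))%N.
Hypothesis LLr : (LL + 5 <= r)%N.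
Let LD al d := (a * d + (e * a + c) * al)%N.

(** A vertical curve is a fibre through a single point of the configuration, so it
    falls under the case M = 1; every other curve is subject to
    [self_intersection_bound]. *)
Lemma curve_seshadri_bound D F i0 : is_curve e D F -> F.@[x i0] = 0 ->
  exists al d : nat, [/\ D = (al%:Z, (e * al + d)%:Z),
    (0 < \sum_i mult (x i) F)%N &
    ((r + 2) * LL * ((\sum_i mult (x i) F) * (\sum_i mult (x i) F))
       <= r * (r + 3) * (LD al d * LD al d))%N].
Proof.
case: gen_y => z_inj w0 gen [sF irrF] Fx0; have [F0 _ _] := irrF.
have [al [be DE]] := section_nonzero sF F0; rewrite {D}DE in sF *.
(* The curve is not C0, so it meets C0 nonnegatively, which is d >= 0. *)
have [mv mvF mv0] : exists2 m, m \in msupp F & m i_v = 0%N.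
  by apply: variable_missing irrF Fx0 _; rewrite /= /affine_coord /= w0.
have ms : exists2 m, m \in msupp F & m i_s = 0%N.
  by apply: variable_missing irrF Fx0 _; rewrite /= /affine_coord /= oner_eq0.
have mu : exists2 m, m \in msupp F & m i_u = 0%N.
  by apply: variable_missing irrF Fx0 _; rewrite /= /affine_coord /= oner_eq0.
have [d beE] : exists d, be = (e * al + d)%N.
  have /monomial_classP[c1 c2] := sF _ mvF; exists (be - e * al)%N.
  by rewrite subnKC // -c2 -c1 mv0 addn0 leq_addl.
subst be; exists al, d.
have f0 : dehom F != 0.
  apply: contraNneq F0 => f0; apply/eqP/(dehom_inj sF); last by rewrite f0 dehom0.
  by move=> m; rewrite msupp0.
have irrf : irreducible2 (dehom F).
  by apply: irreducible_dehom sF irrF _; apply/eval_affine_point/Fx0.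
have tf := section_trapezoid sF.
have exf := tight_trapezoid sF ms mu.
set m := fun i => mult (x i) F.
have vf i : vanishes (m i) (y (lshift r i)) (y (rshift r i)) (dehom F) by apply: mult_vanishes.
have nvf i : ~ vanishes (m i).+1 (y (lshift r i)) (y (rshift r i)) (dehom F).
  exact: mult_sharp.
have m0 : (0 < m i0)%N by apply: mult_gt0.
have M0 : (0 < \sum_i m i)%N by rewrite (bigD1 i0) //= ltn_addr.
have LD0 : (0 < LD al d)%N.
  rewrite lt0n; apply/negP; rewrite /LD addn_eq0 !muln_eq0 addn_eq0 (gtn_eqF c0) andbF /=.
  rewrite (gtn_eqF a0) /= => /andP[/eqP d0 /eqP al0]; case: tf; rewrite d0 al0 => szf wf.
  case: irrf => nc _; apply: nc; have fE := size1_polyC szf.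
  by exists (dehom F)`_0`_0; rewrite fE coefC /=; congr _%:P; apply: size1_polyC; have := wf 0%N; rewrite muln0.
split=> //.
set M := (\sum_i m i)%N in M0 *.
have [M1|M2] : M = 1%N \/ (2 <= M)%N by lia.
  rewrite M1 muln1 [X in (_ <= X)%N](_ : _ = r * (LD al d * LD al d) * (r + 3))%N; last lia.
  rewrite muln1 mulnC; apply: leq_mul; last by lia.
  apply: leq_trans (_ : r * 1 <= _)%N; first by move: LLr; lia.
  by rewrite leq_mul2l muln_gt0 LD0 orbT.
have hodge := hodge_index e a c al d; rewrite -/LL in hodge.
set DD := (al * (d + d + e * al))%N in hodge.
have from_DD : ((r + 2) * (M * M) <= r * (r + 3) * DD)%N ->
    ((r + 2) * LL * (M * M) <= r * (r + 3) * (LD al d * LD al d))%N.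
  move=> h; apply: leq_trans (_ : (r * (r + 3) * (LL * DD) <= _)%N); last by rewrite leq_mul2l hodge orbT.
  by have := leq_mul (leqnn LL) h; lia.
have szf : (1 < size (dehom F))%N.
  rewrite ltnNge; apply/negP => /(vertical_multiplicity irrf)[z0 zP].
  have : (M <= \sum_i (y (lshift r i) == z0))%N by apply: leq_sum => i _; apply: zP (vf i).
  rewrite leqNgt; case/negP; apply: leq_trans M2; rewrite ltnS.
  have [/existsP[i /eqP iz]|/existsPn nz] := boolP [exists i, y (lshift r i) == z0].
    rewrite (bigD1 i) //= big1 => [|j nj]; first by case: (_ == _).
    by rewrite -iz (inj_eq z_inj) (negPf nj).
  by rewrite big1 // => i _; rewrite (negPf (nz i)).
have r6 : (6 <= r)%N.
  apply: leq_trans LLr; rewrite -[6%N]/(1 + 5)%N leq_add2r /LL.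
  by rewrite !(muln_gt0, addn_gt0) a0 c0 orbT.
have [v v0 vnz] := gen al d m _ f0 tf vf.
have self j mj := self_intersection_bound (j := j) z_inj irrf szf tf exf vf mj (nvf j) v0 vnz.
have [m1|[j mj Mle]] := multiplicity_bound r6 M2; last first.
  apply: from_DD; apply: leq_trans Mle _; rewrite leq_mul2l; apply/orP; right.
  case: (self j mj) => [le1|[le2 _]] //; apply: leq_trans le1.
  by apply: leq_sum => i _; rewrite leq_mul2l leq_subr orbT.
have ME : M = r by rewrite /M (eq_bigr (fun=> 1%N)) ?sum1_card ?card_ord.
have [rDD|DDr] := leqP r DD.
  by apply: from_DD; rewrite ME; nia.
(* From here on all m i are 1 and D . D < r, so the first alternative is excluded. *)
have {}self j : (r.-1 <= DD)%N /\ exists g, [/\ trapezoid e al d g,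
    forall i, vanishes (m i - (i == j)) (y (lshift r i)) (y (rshift r i)) g &
    ~ vanishes (m j) (y (lshift r j)) (y (rshift r j)) g].
  have [|le1|[le2 gP]] := self j; first by rewrite m1.
    by move: DDr; rewrite ltnNge; case/negP; apply: leq_trans le1; rewrite (eq_bigr (fun=> 1%N)) ?sum1_card ?card_ord // => i _; rewrite m1.
  split=> //; apply: leq_trans le2.
  rewrite (bigD1 j) //= m1 eqxx subnn muln0 add0n (eq_bigr (fun=> 1%N)) => [|i /negPf nij].
    by rewrite sum1_card cardC1 card_ord.
  by rewrite m1 nij.
have DDE : DD = r.-1.
  have [le _] := self i0; apply/eqP; rewrite eqn_leq le andbT.
  by move: DDr; rewrite -[X in (_ < X)%N](prednK (n := r)) ?ltnS //; lia.
have [g gP] := @boolp.choice _ _ _ (fun j => proj2 (self j)).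
have : (r < #|{: lattice_points e al d}|)%N.
  apply: (independent_sections (y := y) f0 tf (g := g)) => [j|i|i j nij|j].
  - by case: (gP j).
  - by have := vf i; rewrite m1.
  - by have [_ /(_ i)] := gP j; rewrite m1 (negPf nij).
  - by have [_ _] := gP j; rewrite m1.
rewrite card_lattice_points => lt_pts.
by rewrite ME; apply: exceptional_class lt_pts.
Qed.

End Curve.

Lemma affine_points_distinct (R : realType) (e r : nat) (z w : 'I_r -> R[i]) :
  injective z -> distinct_points e (fun i => affine_point (z i) (w i)).
Proof.
move=> z_inj i j nij [lam [mu [_ _ [+ +] _ _]]]; rewrite /= /affine_coord /= mulr1.
by move=> <-; rewrite mul1r => /z_inj ij; rewrite ij eqxx in nij.
Qed.

Lemma sqrt_bound (R : realType) (r LL M N : nat) : (0 < r)%N -> (0 < M)%N ->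
    ((r + 2) * LL * (M * M) <= r * (r + 3) * (N * N))%N ->
  Num.sqrt ((r%:R + 2) / (r%:R + 3)) * Num.sqrt (LL%:R / r%:R) <= N%:R / M%:R :> R.
Proof.
move=> r0 M0 le_sq.
rewrite -sqrtrM ?divr_ge0 ?addr_ge0 ?ler0n //.
have q0 : 0 <= N%:R / M%:R :> R by rewrite divr_ge0 ?ler0n.
rewrite -[leRHS]ger0_norm // -sqrtr_sqr ler_wsqrtr // mulf_div expr_div_n.
rewrite -!(natrD _ r) ler_pdivrMr; last by rewrite -natrM ltr0n muln_gt0 addn_gt0 r0.
rewrite mulrAC ler_pdivlMr; last by rewrite -natrX ltr0n expn_gt0 M0.
rewrite -!natrX -!natrM ler_nat !expnS !expn0 !muln1; lia.
Qed.

Theorem theorem3p8 (R : realType) (e : nat) (L : line_bundle)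
    (ampleL : ample R e L) (r : nat)
    (hr : intersection e L L + 5 <= r%:Z) :
  ((Num.sqrt ((r%:R + 2) / (r%:R + 3))
     * Num.sqrt ((intersection e L L)%:~R / r%:R))%:E <= seshadri R e L r)%E.
Proof.
have [a [c [a0 c0 LE]]] := ample_bounds ampleL.
have LLE : intersection e L L = (a * (e * a + 2 * c))%N%:Z.
  by rewrite LE /intersection /=; lia.
have LLr : (a * (e * a + 2 * c) + 5 <= r)%N by move: hr; rewrite LLE; lia.
have [y gen_y] := very_general_exists R e r; have [z_inj _ _] := gen_y.
pose x i := affine_point (y (lshift r i)) (y (rshift r i)).
apply: le_trans (_ : (seshadri_at e L x <= _)%E); last first.
  by apply: ereal_sup_ubound; exists x => //; apply: affine_points_distinct.
apply: le_ereal_inf_tmp => _ [D [F [curveF [i0 Fx0] ->]]].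
have [al [d [DE M0 le_sq]]] := curve_seshadri_bound gen_y a0 c0 LLr curveF Fx0.
have LDE : intersection e L D = (a * d + (e * a + c) * al)%N%:Z.
  by rewrite LE DE /intersection /=; lia.
rewrite lee_fin LLE LDE -!pmulrn; apply: sqrt_bound => //.
by apply: leq_trans LLr; rewrite addnC.
Qed.
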